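(* Let $D$ be an ADDB-domain with quotient field $K$. (1) For each $n\ge 1$, $\mathrm{Int}_K(\Lambda_n)$ is a Prüfer domain. (2) Let $A$ be a $D$-algebra that is torsion-free and finitely generated as a $D$-module, and such that $A\cap K=D$. Then $\mathrm{Int}_K(A,A')$ is a Prüfer domain.
   Context: Algebras are associative and unital, not necessarily commutative. $K$ and $A$ are embedded in $B=A\otimes_D K=(D\setminus\{0\})^{-1}A$ via $k\mapsto 1\otimes k$ and $a\mapsto a\otimes 1$; $A\cap K=D$ is meant inside $B$. ADDB-domain: an integral domain $D$, not a field, is an almost Dedekind domain if $D_M$ is a discrete valuation ring for each maximal ideal $M$. Let $D$ be almost Dedekind with all residue fields finite. Then $D$ contains a principal ideal domain $D_0$, where $D_0\cong\mathbb{Z}$ if $\mathrm{char}(K)=0$, and $D_0\cong F[t]$ (polynomial ring in one variable over the prime field $F$ with $\mathrm{char}(K)$ elements) if $\mathrm{char}(K)>0$. For a nonzero prime element $p$ of $D_0$ and a prime $P$ of $D$ above $p$ (i.e. $P\cap D_0=pD_0$), let $e_{P,p}=v_P(p)$, with $v_P$ the normalized $P$-adic valuation on $K$, and $f_{P,p}=[D/P:D_0/pD_0]$. $D$ satisfies the double-boundedness condition if, for each $p$, the sets $\{e_{P,p}\}$ and $\{f_{P,p}\}$ ($P$ ranging over the primes of $D$ above $p$) are both bounded. $D$ is an ADDB-domain if it is an almost Dedekind domain with finite residue fields satisfying the double-boundedness condition. Fix an algebraic closure $\overline{K}$ of $K$. $\Lambda_n=\{\alpha\in\overline{K}\mid\alpha$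 is a root of a monic polynomial in $D[X]$ of degree $n\}$ and $\mathrm{Int}_K(\Lambda_n)=\{f\in K[X]\mid f(\Lambda_n)\subseteq\Lambda_n\}$. $A'$ is the set of elements of $B$ that are roots of monic polynomials in $D[X]$ (possibly not a ring), and $\mathrm{Int}_K(A,A')=\{f\in K[X]\mid f(A)\subseteq A'\}$, which is known to be a ring. *)

(* Defs.v *)
From HB Require Import structures.
From mathcomp Require Import all_boot all_order all_algebra.
From mathcomp Require Import boolp classical_sets cardinality.

Set Implicit Arguments.
Unset Strict Implicit.
Unset Printing Implicit Defensive.

Import Order.TTheory GRing.Theory Num.Theory.
Local Open Scope classical_set_scope.
Local Open Scope ring_scope.

(* The quotient field of [D] is [{fraction D}]; [x%:F] is the image of [x]. *)
Notation tofrac := (@FracField.tofrac _).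
Notation "x %:F" := (FracField.tofrac x) : ring_scope.

Section Ideals.
Variable D : idomainType.
Implicit Types (I P M S : set D).

(* [idealr_closed] already contains properness ([1 \notin I]). *)
Definition prime_ideal P :=
  idealr_closed [in P] /\ prime_idealr_closed [in P].

Definition maximal_ideal M :=
  idealr_closed [in M] /\
  forall J : set D, idealr_closed [in J] -> M `<=` J -> J = M.

Definition quotient_set I : set (set D) :=
  range (fun x : D => [set y | I (y - x)]).

Definition localization P : set {fraction D} :=
  [set x | exists a s : D, ~ P s /\ x = a%:F / s%:F].

Definition principal_in S (p : D) : set D := [set p * c | c in S].

(* A nonzero prime element of the subring [S]; divisibility is taken in [S]. *)
Definition prime_element_in S (p : D) :=
  [/\ S p, p != 0, ~ principal_in S p 1 &
      forall a b, S a -> S b -> principal_in S p (a * b) ->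
        principal_in S p a \/ principal_in S p b].

End Ideals.

Section Valuations.
Variable K : fieldType.

(* The value at [0], which should be infinite, is left unspecified. *)
Definition normalized_valuation (v : K -> int) :=
  [/\ forall x y : K, x != 0 -> y != 0 -> v (x * y) = v x + v y,
      forall x y : K, x != 0 -> y != 0 -> x + y != 0 ->
        Num.min (v x) (v y) <= v (x + y)
    & forall m : int, exists2 x : K, x != 0 & v x = m].

Definition valuation_ring (v : K -> int) : set K :=
  [set x | x = 0 \/ 0 <= v x].

Definition discrete_valuation_ring (V : set K) :=
  exists2 v, normalized_valuation v & V = valuation_ring v.

End Valuations.

Definition almost_dedekind (D : idomainType) :=
  ~ GRing.field_axiom D /\
  forall M : set D, maximal_ideal M -> discrete_valuation_ring (localization M).

Definition finite_residue_fields (D : idomainType) :=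
  forall M : set D, maximal_ideal M -> finite_set (quotient_set M).

Section DoubleBoundedness.
Variable D : idomainType.
Implicit Types (P : set D) (p : D).

Definition base_ring (D0 : set D) :=
  ([pchar {fraction D}] =i pred0 /\
     exists2 phi : {rmorphism int -> D}, injective phi & D0 = range phi) \/
  (exists q : nat, q \in [pchar {fraction D}] /\
     exists2 phi : {rmorphism {poly 'F_q} -> D},
       injective phi & D0 = range phi).

Definition prime_above (D0 : set D) p P :=
  prime_ideal P /\ P `&` D0 = principal_in D0 p.

Definition adic_valuation P (v : {fraction D} -> int) :=
  normalized_valuation v /\ localization P = valuation_ring v.

(* [d] is the dimension of [D / P] over [D0 / (P `&` D0)]: the classes of     *)
(* [b 0, ..., b (d - 1)] form a basis. A scalar in [D0] is zero modulo        *)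
(* [P `&` D0] exactly when it lies in [P].                                    *)
Definition residue_degree (D0 : set D) P (d : nat) :=
  exists b : 'I_d -> D,
    (forall x, exists c : 'I_d -> D,
       (forall i, D0 (c i)) /\ P (x - \sum_i c i * b i)) /\
    (forall c : 'I_d -> D, (forall i, D0 (c i)) ->
       P (\sum_i c i * b i) -> forall i, P (c i)).

Definition ramification_indices (D0 : set D) p : set int :=
  [set e | exists P v,
     [/\ prime_above D0 p P, adic_valuation P v & e = v p%:F]].

Definition residue_degrees (D0 : set D) p : set nat :=
  [set f | exists P, prime_above D0 p P /\ residue_degree D0 P f].

Definition doubly_bounded (D0 : set D) :=
  forall p, prime_element_in D0 p ->
    has_ubound (ramification_indices D0 p) /\ has_ubound (residue_degrees D0 p).

End DoubleBoundedness.

(* In positive characteristic the choice of [D0] is not canonical; the        *)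
(* condition does not depend on it, and is only required for some choice.     *)
Definition ADDB_domain (D : idomainType) :=
  [/\ almost_dedekind D, finite_residue_fields D
    & exists2 D0 : set D, base_ring D0 & doubly_bounded D0].

Section Prufer.
Variable L : fieldType.
Implicit Types (S I J : set L).

Definition ideal_span S (n : nat) (a : 'I_n -> L) : set L :=
  [set x | exists c : 'I_n -> L, (forall i, S (c i)) /\ x = \sum_i c i * a i].

Definition ideal_inverse S I : set L :=
  [set x | forall y, I y -> S (x * y)].

Definition ideal_product I J : set L :=
  [set x | exists n (a b : 'I_n -> L),
     [/\ forall i, I (a i), forall i, J (b i) & x = \sum_i a i * b i]].

Definition invertible_ideal S I := ideal_product I (ideal_inverse S I) = S.

(* The inverse of a nonzero ideal of [S], computed in [L], lies in the        *)
(* quotient field of [S] inside [L].                                          *)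
Definition prufer_domain S :=
  subring_closed [in S] /\
  forall (n : nat) (a : 'I_n -> L), (forall i, S (a i)) ->
    ideal_span S a <> [set 0] -> invertible_ideal S (ideal_span S a).

End Prufer.

Definition algebraic_closure (K : fieldType) (Kbar : closedFieldType)
    (j : {rmorphism K -> Kbar}) :=
  forall x : Kbar, algebraicOver j x.

Section IntLambda.
Variables (D : idomainType) (Kbar : closedFieldType).
Variable j : {rmorphism {fraction D} -> Kbar}.

Definition Lambda (n : nat) : set Kbar :=
  [set x | exists p : {poly D}, [/\ p \is monic, size p = n.+1
     & root (map_poly j (map_poly tofrac p)) x]].

Definition Int_Lambda (n : nat) : set {poly {fraction D}} :=
  [set f | forall x, Lambda n x -> Lambda n (map_poly j f).[x]].

End IntLambda.

Definition torsion_free (D : idomainType) (A : lmodType D) :=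
  forall (d : D) (a : A), d *: a = 0 -> d = 0 \/ a = 0.

Definition finitely_generated (D : idomainType) (A : lmodType D) :=
  exists n (g : 'I_n -> A), forall a, exists c : 'I_n -> D,
    a = \sum_i c i *: g i.

Section IntAlgebra.
Variables (D : idomainType) (A : algType D) (B : algType {fraction D}).
Variable iota : {rmorphism A -> B}.

(* [B], with [iota], is the localization of [A] at the nonzero elements of    *)
(* [D]; this determines the K-algebra [B] up to a unique isomorphism.         *)
Definition scalar_extension :=
  [/\ forall (d : D) (a : A), iota (d *: a) = d%:F *: iota a,
      forall a, iota a = 0 -> exists2 d : D, d != 0 & d *: a = 0
    & forall b : B, exists (d : D) (a : A),
        d != 0 /\ b = (d%:F)^-1 *: iota a].

Definition image_A : set B := range iota.
Definition image_K : set B := range (fun k : {fraction D} => k%:A).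
Definition image_D : set B := range (fun d : D => (d%:F)%:A).

Definition integral_elements : set B :=
  [set b | exists2 p : {poly D}, p \is monic
     & horner_alg b (map_poly tofrac p) = 0].

Definition Int_alg : set {poly {fraction D}} :=
  [set f | forall a : A, integral_elements (horner_alg (iota a) f)].

End IntAlgebra.

Arguments image_K {D} B _.
Arguments image_D {D} B _.

(* Main.v *)
(* Call a place a point [x] in an extension field of [K], root of a monic     *)
(* polynomial of degree at most [n] over [D], together with a valuation ring  *)
(* [W] containing [D] of that field.  Since integral closures are             *)
(* intersections of valuation rings, both rings of the theorem have the form  *)
(* [S = {f | f(x) in W for every place in T}].                                *)
(*                                                                            *)
(* Fix a nonzero [d] in [D].  Double-boundedness gives [N] and [m] such that, *)
(* at every place where [v d > 0], each nonzero [y] in [K(x)] has [y^N]       *)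
(* associate to a power of [d], and [y^m - y] lies in the maximal ideal when  *)
(* [y] is in [W].  Hence if [h = w^N / d^i] is in [S], then so is             *)
(* [h (1 - h^(m-1))^N / d]: either [h] is a unit and [1 - h^(m-1)] is not, or *)
(* [d] divides [h].  Iterating, for [w] in [S] one gets [u] and [k] in [S]    *)
(* with [(w u)^N / d^i] in [S] and [(1 - u) d^i = w^N k]: [u] separates the   *)
(* places according to which of [w^N] and [d^i] divides the other.            *)
(*                                                                            *)
(* A finitely generated ideal of [S] becomes principal over [K[X]], so up to  *)
(* scaling its generators [a_i] satisfy [sum_i c_i a_i = d].  Iterating the   *)
(* form [X^m - X Y^(m-1) + Y^m], which has no zero in the residue fields,     *)
(* yields [w = sum_i a_i b_i] with [v w = M min_i (v a_i)]; with [u] and [k]  *)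
(* as above for [i = M N], the elements                                       *)
(* [k b_i w^(N-1) / d^(M N) + u c_i / d] invert the ideal.                    *)

Require Import Defs.
From HB Require Import structures.
From mathcomp Require Import all_boot all_order all_algebra.
From mathcomp Require Import boolp classical_sets cardinality.
From mathcomp Require Import all_field generic_quotient ring zify.
Set Implicit Arguments.
Unset Strict Implicit.
Unset Printing Implicit Defensive.
Import Order.TTheory GRing.Theory Num.Theory.
Local Open Scope classical_set_scope.
Local Open Scope ring_scope.

(** * Valuation rings *)

(** Integrality is membership in all valuation rings ([integralP]), so both rings of the theorem are
    of the form [integral_at T] for a family [T] of places ([Int_LambdaE], [Int_algE]). The points
    of these places have degree at most [n] over [K]. Combined with the bounds on ramification and
    residue fields above a nonzero [d] ([ADDB_bounded]), this controls value groups and residue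
    fields uniformly over all places where [d] is not a unit ([integral_place_uniform]).

    Uniformity lets a single polynomial identity act at all places at once. Bounded residue fields
    give [norm_form]: an element [w] of the ideal whose value is prescribed by the smallest value of
    the generators. Commensurable value groups give [split_unit]: an element [u] of the ring that
    glues two local inverses. In [invertible_of_const] the one built from [w] gets weight [1 - u],
    and the one read off a relation with constant value [d] gets weight [u]. Since [K[X]] is
    principal, [prufer_integral_at] reduces every finitely generated ideal to one with such a
    relation. *)

Definition is_valuation_ring (L : fieldType) (W : set L) :=
  [/\ W 1, forall x y, W x -> W y -> W (x - y),
      forall x y, W x -> W y -> W (x * y)
    & forall x, W x \/ W x^-1].

(* [vle W x y] reads [v x <= v y] for the valuation [v] attached to [W], with *)
(* [v 0] infinite, and [vpos W x] reads [0 < v x].                            *)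
Definition vle (L : fieldType) (W : set L) (x y : L) :=
  exists2 w, W w & y = w * x.

Definition vpos (L : fieldType) (W : set L) (x : L) := ~ vle W x 1.

Definition veq (L : fieldType) (W : set L) (x y : L) := vle W x y /\ vle W y x.

Section ValuationRing.
Variables (L : fieldType) (W : set L).
Hypothesis vrW : is_valuation_ring W.
Implicit Types x y z t : L.

Lemma vr1 : W 1. Proof. by case: vrW. Qed.
Lemma vrB x y : W x -> W y -> W (x - y).
Proof. by case: vrW => _ h _ _; apply: h. Qed.
Lemma vrM x y : W x -> W y -> W (x * y).
Proof. by case: vrW => _ _ h _; apply: h. Qed.
Lemma vr_total x : W x \/ W x^-1. Proof. by case: vrW. Qed.
Lemma vr0 : W 0. Proof. by rewrite -(subrr 1); apply: vrB vr1 vr1. Qed.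
Lemma vrN x : W x -> W (- x). Proof. by rewrite -sub0r; apply: vrB vr0. Qed.
Lemma vrD x y : W x -> W y -> W (x + y).
Proof. by move=> Wx Wy; rewrite -[y]opprK; apply/vrB/vrN. Qed.
Lemma vrX n x : W x -> W (x ^+ n).
Proof. by move=> Wx; elim: n => [|n IH]; [exact: vr1 | rewrite exprS;
  apply: vrM]. Qed.
Lemma vr_sum (I : Type) (r : seq I) (P : pred I) (F : I -> L) :
  (forall i, P i -> W (F i)) -> W (\sum_(i <- r | P i) F i).
Proof. by move=> h; apply: (big_ind W) => //; [exact: vr0 | exact: vrD]. Qed.

Lemma vle1 x : vle W 1 x <-> W x.
Proof.
by split=> [[w Ww ->] | Wx]; [rewrite mulr1 | exists x => //; rewrite mulr1].
Qed.

Lemma vle_refl x : vle W x x.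
Proof. by exists 1; [exact: vr1 | rewrite mul1r]. Qed.

Lemma vle_trans y x z : vle W x y -> vle W y z -> vle W x z.
Proof.
by move=> [w Ww ->] [u Wu ->]; exists (u * w); [exact: vrM | rewrite mulrA].
Qed.

Lemma vle0 x : vle W x 0.
Proof. by exists 0; [exact: vr0 | rewrite mul0r]. Qed.

Lemma vleM x y z t : vle W x y -> vle W z t -> vle W (x * z) (y * t).
Proof.
move=> [w Ww ->] [u Wu ->]; exists (w * u); [exact: vrM | by ring].
Qed.

Lemma vleMl z x y : vle W x y -> vle W (z * x) (z * y).
Proof. exact/vleM/vle_refl. Qed.

Lemma vleX n x y : vle W x y -> vle W (x ^+ n) (y ^+ n).
Proof.
by move=> h; elim: n => [|n IH]; rewrite ?expr0 ?exprS;
  [exact: vle_refl | exact: vleM].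
Qed.

Lemma vle_mulW x y w : W w -> vle W x y -> vle W x (w * y).
Proof. by move=> Ww h; apply: (vle_trans h); exists w. Qed.

Lemma vleD x y z : vle W x y -> vle W x z -> vle W x (y + z).
Proof.
by move=> [w Ww ->] [u Wu ->]; exists (w + u); [exact: vrD | rewrite mulrDl].
Qed.

Lemma vleN x y : vle W x y -> vle W x (- y).
Proof. by move=> [w Ww ->]; exists (- w); [exact: vrN | rewrite mulNr]. Qed.

Lemma vleB x y z : vle W x y -> vle W x z -> vle W x (y - z).
Proof. by move=> h1 h2; apply/vleD/vleN. Qed.

Lemma vle_sum x (I : Type) (r : seq I) (P : pred I) (F : I -> L) :
  (forall i, P i -> vle W x (F i)) -> vle W x (\sum_(i <- r | P i) F i).
Proof. by move=> h; apply: (big_ind (vle W x)) => //;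
  [exact: vle0 | exact: vleD]. Qed.

Lemma vle_total x y : vle W x y \/ vle W y x.
Proof.
have [-> | x0] := eqVneq x 0; first by right; exact: vle0.
have [-> | y0] := eqVneq y 0; first by left; exact: vle0.
case: (vr_total (y / x)) => h; [left | right].
  by exists (y / x) => //; rewrite divfK.
by exists (y / x)^-1 => //; rewrite invf_div divfK.
Qed.

Lemma vle_eq0 x y : vle W x y -> x = 0 -> y = 0.
Proof. by move=> [w _ ->] ->; rewrite mulr0. Qed.

Lemma vle_div x y : x != 0 -> vle W x y <-> W (y / x).
Proof.
move=> x0; split=> [[w Ww ->]|h]; first by rewrite mulfK.
by exists (y / x) => //; rewrite divfK.
Qed.

Lemma vleV x y : x != 0 -> y != 0 -> vle W x y -> vle W y^-1 x^-1.
Proof.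
move=> x0 y0 [w Ww e]; exists w => //; rewrite e; field.
by rewrite x0 /=; apply: contraNneq y0 => w0; rewrite e w0 mul0r.
Qed.

Lemma vposP x : vpos W x -> W x.
Proof. by move=> h; case: (vle_total x 1) => // /vle1. Qed.

Lemma vpos0 : vpos W 0.
Proof. by move=> /vle_eq0 /(_ erefl) /eqP; rewrite oner_eq0. Qed.

Lemma vpos_le x y : vpos W x -> vle W x y -> vpos W y.
Proof. by move=> h h1 h2; apply: h; apply: vle_trans h2. Qed.

Lemma vposMl x y : W x -> vpos W y -> vpos W (x * y).
Proof. by move=> Wx /vpos_le; apply; exists x. Qed.

Lemma vposD x y : vpos W x -> vpos W y -> vpos W (x + y).
Proof.
move=> hx hy; case: (vle_total x y) => h.
  by apply: (vpos_le hx); apply: vleD => //; exact: vle_refl.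
by apply: (vpos_le hy); apply: vleD => //; exact: vle_refl.
Qed.

Lemma vposN x : vpos W x -> vpos W (- x).
Proof. by rewrite -mulN1r; apply: vposMl; apply/vrN/vr1. Qed.

Lemma vposB x y : vpos W x -> vpos W y -> vpos W (x - y).
Proof. by move=> hx hy; apply/vposD/vposN. Qed.

Lemma vpos_sum (I : Type) (r : seq I) (P : pred I) (F : I -> L) :
  (forall i, P i -> vpos W (F i)) -> vpos W (\sum_(i <- r | P i) F i).
Proof. by move=> h; apply: (big_ind (vpos W)) => //;
  [exact: vpos0 | exact: vposD]. Qed.

Lemma vpos_unitD x y : vle W x 1 -> vpos W y -> vle W (x + y) 1.
Proof.
move=> hx hy; apply: contrapT => hxy.
by move: hx; apply: (_ : vpos W x); rewrite -(addrK y x); apply: vposB.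
Qed.

Lemma vposM x y : vpos W (x * y) -> vpos W x \/ vpos W y.
Proof.
move=> h; case: (pselect (vle W x 1)) => hx; last by left.
by right=> hy; apply: h; rewrite -[1]mulr1; apply: vleM.
Qed.

Lemma vposX n x : vpos W (x ^+ n) -> vpos W x.
Proof.
elim: n => [|n IH]; first by rewrite expr0 => /(_ (vle_refl _)).
by rewrite exprS => /vposM[].
Qed.

Lemma vpos_exp n x : (0 < n)%N -> vpos W x -> vpos W (x ^+ n).
Proof.
by case: n => // n _ h; rewrite exprSr; apply: vposMl => //; apply/vrX/vposP.
Qed.

Lemma vpos_div x y : x != 0 -> ~ vle W y x -> vpos W (y / x).
Proof.
by move=> x0 h [w Ww e]; apply: h; exists w => //;
  rewrite -[LHS]mul1r e mulrA divfK.
Qed.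

(** The value group is totally ordered: if [v y < v x], then [x / y] is positive, hence so is its
    [n]-th power. *)
Lemma vle_expK n x y : (0 < n)%N -> vle W (x ^+ n) (y ^+ n) -> vle W x y.
Proof.
move=> n0 h; apply: contrapT => hxy; apply: (hxy).
have [y0|y0] := eqVneq y 0; first by rewrite y0; apply: vle0.
have /(vpos_exp n0) [] := vpos_div y0 hxy.
case: h => w Ww e; exists w => //.
by rewrite expr_div_n mulrA -e divff // expf_neq0.
Qed.

Lemma veq_refl x : veq W x x. Proof. by split; apply: vle_refl. Qed.
Lemma veq_sym x y : veq W x y -> veq W y x. Proof. by case. Qed.
Lemma veq_trans y x z : veq W x y -> veq W y z -> veq W x z.
Proof. by move=> [a b] [c d]; split; apply: vle_trans; eassumption. Qed.
Lemma veqM x y z t : veq W x y -> veq W z t -> veq W (x * z) (y * t).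
Proof. by move=> [a b] [c d]; split; apply: vleM. Qed.
Lemma veqX n x y : veq W x y -> veq W (x ^+ n) (y ^+ n).
Proof. by move=> [a b]; split; apply: vleX. Qed.
Lemma veq_neq0 x y : veq W x y -> x != 0 -> y != 0.
Proof. by move=> [_ h]; apply: contraNneq => /(vle_eq0 h)/eqP. Qed.
Lemma veqV x y : x != 0 -> veq W x y -> veq W x^-1 y^-1.
Proof.
by move=> x0 h; have y0 := veq_neq0 h x0; case: h => a b; split; apply: vleV.
Qed.
Lemma veqXz (k : int) x y : x != 0 -> veq W x y -> veq W (x ^ k) (y ^ k).
Proof.
move=> x0 h; case: k => k; first exact: veqX.
by rewrite !NegzE -!exprnN; apply: veqV; [rewrite expf_neq0 | exact: veqX].
Qed.

Lemma vpos_exprz (k : int) x : W (x ^ k) -> vpos W x -> x != 0 -> 0 <= k.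
Proof.
case: k => // k; rewrite NegzE -exprnN => h hx x0.
case: (vpos_exp (ltn0Sn k) hx); exists (x ^- k.+1) => //.
by rewrite mulVf // expf_neq0.
Qed.

Lemma exists_min_value (x : nat -> L) n : (0 < n)%N ->
  exists2 l, (l < n)%N & forall i, (i < n)%N -> vle W (x l) (x i).
Proof.
elim: n => // -[_ _|n /(_ isT) [l ln hl] _].
  by exists 0%N => // -[|//] _; exact: vle_refl.
case: (vle_total (x l) (x n.+1)) => h.
  exists l; first exact: ltnW.
  by move=> i; rewrite ltnS leq_eqVlt => /orP[/eqP->|/hl].
exists n.+1 => // i; rewrite ltnS leq_eqVlt => /orP[/eqP->|/hl].
  exact: vle_refl.
exact: vle_trans.
Qed.

(* If all terms had distinct valuations, the sum would have the smallest one. *)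
Lemma sum0_veq (n : nat) (z : 'I_n -> L) :
  \sum_i z i = 0 -> (exists i, z i != 0) ->
  exists i k : 'I_n, [/\ i != k, z i != 0 & veq W (z i) (z k)].
Proof.
move=> s0 [i0 zi0].
have [i zi hi] : exists2 i, z i != 0 & forall k, vle W (z i) (z k).
  have : forall m, (m <= n)%N -> exists2 i, z i != 0 &
      forall k : 'I_n, (k < m)%N -> vle W (z i) (z k).
    elim=> [|m IH] hm; first by exists i0.
    have [i zi hi] := IH (ltnW hm); pose l := Ordinal hm.
    have leP (k : 'I_n) : (k < m.+1)%N -> (k < m)%N \/ k = l.
      by rewrite ltnS leq_eqVlt => /orP[/eqP e|]; [right;
        apply: val_inj | left].
    case: (vle_total (z i) (z l)) => h.
      by exists i => // k /leP[/hi//|->].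
    case: (eqVneq (z l) 0) => [zl0|zl].
      by exists i => // k /leP[/hi//|->]; rewrite zl0; apply: vle0.
    exists l => // k /leP[/hi|->]; last exact: vle_refl.
    exact: vle_trans.
  by move=> /(_ n (leqnn _)) [i zi hi]; exists i => // k; apply: hi.
apply: contrapT => hn.
have hk k : k != i -> vpos W (z k / z i).
  move=> ki; apply: vpos_div => // h; apply: hn; exists i, k; split=> //.
  by rewrite eq_sym.
have : vpos W (\sum_(k | k != i) z k / z i) by apply: vpos_sum.
rewrite -mulr_suml; move: s0; rewrite (bigD1 i) //= => /eqP.
rewrite addrC addr_eq0 => /eqP ->; rewrite mulNr divff //.
by move=> /vposN; rewrite opprK; apply; exact: vle_refl.
Qed.

(** Valuation rings are integrally closed. If [x^-1] lies in [W], dividing the monic equation by a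
    power of [x] writes [x] as a polynomial in [x^-1] over [W]. *)
Lemma integral_in_vr (p : {poly L}) x : p \is monic -> (forall i, W p`_i) ->
  root p x -> W x.
Proof.
move=> mp Wp px; case: (vr_total x) => // Wy.
have [x0|x0] := eqVneq x 0; first by rewrite x0; exact: vr0.
have sp : (0 < size p)%N by rewrite lt0n size_poly_eq0 monic_neq0.
move: (mp) => /monicP; rewrite /lead_coef => lp.
have [n en] : exists n, size p = n.+1 by exists (size p).-1; rewrite prednK.
move: px; rewrite /root horner_coef en big_ord_recr /= -[X in p`_X]/(n.+1.-1)
  -en lp mul1r.
case: n en => [|n] en.
  by rewrite big_ord0 add0r expr0 oner_eq0.
rewrite addrC addr_eq0 => /eqP e.
have -> : x = - \sum_(i < n.+1) p`_i * x^-1 ^+ (n - i).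
  apply: (mulIf (expf_neq0 n x0)); rewrite -exprS e mulNr mulr_suml;
    congr (- _).
  apply: eq_bigr => i _; rewrite -mulrA; congr (_ * _).
  have -> : x ^+ n = x ^+ (n - i) * x ^+ i by rewrite -exprD subnK // -ltnS.
  by rewrite exprVn mulrA mulVf ?mul1r // expf_neq0.
by apply/vrN/vr_sum => i _; apply: vrM => //; apply: vrX.
Qed.

End ValuationRing.

(** * Rings cut out by a family of places *)

(** [pl_field] may be much larger than the field generated by the point, as with [Kbar]; this is why
    conditions on values are imposed on [range (pl_eval t)] only. *)
Record place (K : fieldType) := Place {
  pl_field : fieldType;
  pl_mor : {rmorphism K -> pl_field};
  pl_pt : pl_field;
  pl_ring : set pl_field }.
Arguments pl_ring {K} p _.

Definition pl_eval (K : fieldType) (t : place K) :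
    {rmorphism {poly K} -> pl_field t} :=
  (horner_eval (pl_pt t) \o map_poly (pl_mor t))%FUN.

Lemma pl_evalE (K : fieldType) (t : place K) f :
  pl_eval t f = (map_poly (pl_mor t) f).[pl_pt t].
Proof. by []. Qed.

Lemma pl_evalC (K : fieldType) (t : place K) c : pl_eval t c%:P = pl_mor t c.
Proof. by rewrite pl_evalE map_polyC hornerC. Qed.

Definition integral_at (K : fieldType) (T : place K -> Prop) : set {poly K} :=
  [set f | forall t, T t -> pl_ring t (pl_eval t f)].

(* At the places where [d] is not a unit, the value groups are commensurable  *)
(* with [v d] and the residue fields are finite, both with a bound that does  *)
(* not depend on the place.                                                   *)
Definition uniform_at (K : fieldType) (T : place K -> Prop) (d : K) :=
  exists N m, [/\ (0 < N)%N, (1 < m)%N & forall t, T t ->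
    vpos (pl_ring t) (pl_mor t d) -> forall x, range (pl_eval t) x ->
    (x != 0 -> exists k : int, veq (pl_ring t) (x ^+ N) (pl_mor t d ^ k)) /\
    (pl_ring t x -> vpos (pl_ring t) (x ^+ m - x))].

Section IntegralAt.
Variables (K : fieldType) (T : place K -> Prop).
Hypothesis vrT : forall t, T t -> is_valuation_ring (pl_ring t).
Local Notation S := (integral_at T).

Lemma integral_at1 : S 1.
Proof. by move=> t Tt; rewrite rmorph1; exact: vr1 (vrT Tt). Qed.
Lemma integral_atB f g : S f -> S g -> S (f - g).
Proof. by move=> hf hg t Tt; rewrite rmorphB; apply: vrB (vrT Tt) _ _ _ _;
  auto. Qed.
Lemma integral_atM f g : S f -> S g -> S (f * g).
Proof. by move=> hf hg t Tt; rewrite rmorphM; apply: vrM (vrT Tt) _ _ _ _;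
  auto. Qed.
Lemma integral_at0 : S 0.
Proof. by rewrite -(subrr 1);
  apply: integral_atB integral_at1 integral_at1. Qed.
Lemma integral_atD f g : S f -> S g -> S (f + g).
Proof.
move=> hf hg; rewrite -[g]opprK -[- g]sub0r.
by apply: integral_atB hf (integral_atB integral_at0 hg).
Qed.
Lemma integral_atX n f : S f -> S (f ^+ n).
Proof. by move=> hf t Tt; rewrite rmorphXn; apply: vrX (vrT Tt) _ _ _;
  auto. Qed.
Lemma integral_at_sum (I : Type) (r : seq I) (P : pred I) (F : I -> {poly K}) :
  (forall i, P i -> S (F i)) -> S (\sum_(i <- r | P i) F i).
Proof.
by move=> h; apply: (big_ind S) => //;
  [exact: integral_at0 | exact: integral_atD].
Qed.

(** * Separating places and inverting ideals, relative to a fixed constant [d] *)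

Section Uniform.
Variables (d : K) (N m : nat).
Hypothesis d0 : d != 0.
Hypothesis N0 : (0 < N)%N.
Hypothesis m1 : (1 < m)%N.
Hypothesis Sd : S d%:P.
Hypothesis groupT : forall t, T t -> vpos (pl_ring t) (pl_mor t d) ->
  forall x, range (pl_eval t) x -> x != 0 ->
  exists k : int, veq (pl_ring t) (x ^+ N) (pl_mor t d ^ k).
Hypothesis residueT : forall t, T t -> vpos (pl_ring t) (pl_mor t d) ->
  forall x, range (pl_eval t) x -> pl_ring t x ->
  vpos (pl_ring t) (x ^+ m - x).

(** The quotient is associate to an integral power of [d], and positivity forces the exponent to be
    at least one. *)
Lemma vpos_pow_le t (Tt : T t) x : vpos (pl_ring t) (pl_mor t d) ->
  range (pl_eval t) x -> forall i : nat,
  vpos (pl_ring t) (x ^+ N / pl_mor t d ^+ i) ->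
  vle (pl_ring t) (pl_mor t d) (x ^+ N / pl_mor t d ^+ i).
Proof.
move=> hd hx i h; have vr := vrT Tt.
have jd0 : pl_mor t d != 0 by rewrite fmorph_eq0.
have [x0|x0] := eqVneq x 0.
  by rewrite x0 expr0n gtn_eqF // mul0r; apply: vle0.
have [k hk] := groupT Tt hd hx x0.
have hk' : veq (pl_ring t) (x ^+ N / pl_mor t d ^+ i) (pl_mor t d ^ (k - i%:Z)).
  rewrite expfzDr // -exprnN; apply: (veqM vr hk); exact: veq_refl vr _.
have : vpos (pl_ring t) (pl_mor t d ^ (k - i%:Z)).
  by case: hk' => h1 _; apply: vpos_le h h1.
case: (k - i%:Z) hk' => [[|l]|l] hk' h1.
- by case: (h1); rewrite expr0z; apply: vle_refl.
- apply: vle_trans hk'.2 => //; rewrite -exprnP exprSr.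
  by apply: vle_mulW => //; [apply: vrX => //; exact: vposP | exact: vle_refl].
- have /(vpos_exprz vr) /(_ hd jd0) // := vposP vr h1.
Qed.

(** With [h = (w u)^N / d^j], the new element is [h (1 - h^(m-1))^N / d]. Over [d], a positive [h]
    is divisible by [d]. If [h] is a unit, then [1 - h^(m-1)] is positive because [h - h^m] is, so
    its [N]-th power is divisible by [d]. *)
Lemma split_step w u j :
  S ((d^-1)%:P ^+ j * (w * u) ^+ N) ->
  S ((d^-1)%:P ^+ j.+1 *
     (w * (u * (1 - ((d^-1)%:P ^+ j * (w * u) ^+ N) ^+ m.-1))) ^+ N).
Proof.
set h := _ * _ => Sh t Tt; have vr := vrT Tt.
have -> : (d^-1)%:P ^+ j.+1 * (w * (u * (1 - h ^+ m.-1))) ^+ N =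
   (d^-1)%:P * (h * (1 - h ^+ m.-1) ^+ N).
  rewrite mulrA exprMn {2}/h exprS; ring.
have jd0 : pl_mor t d != 0 by rewrite fmorph_eq0.
have Wh := Sh t Tt.
have Wh1 : pl_ring t (pl_eval t (1 - h ^+ m.-1)).
  by apply: integral_atB Tt; [exact: integral_at1 | exact: integral_atX].
rewrite rmorphM pl_evalC fmorphV mulrC; apply/(vle_div _ _ jd0);
  rewrite rmorphM rmorphXn.
case: (pselect (vpos (pl_ring t) (pl_mor t d))) => [hd|/contrapT hd];
  last first.
  by apply: (vle_trans vr hd); apply/vle1; apply: vrM => //; apply: vrX.
case: (pselect (vpos (pl_ring t) (pl_eval t h))) => [hh|/contrapT hh].
  rewrite mulrC; apply: vle_mulW => //; first exact: vrX.
  move: hh; have -> : pl_eval t h = (pl_eval t (w * u)) ^+ N / pl_mor t d ^+ j.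
    by rewrite rmorphM !rmorphXn pl_evalC fmorphV mulrC exprVn.
  by apply: vpos_pow_le => //; exists (w * u).
apply: vle_mulW => //.
have := @vpos_pow_le _ Tt (pl_eval t (1 - h ^+ m.-1)) hd _ 0.
rewrite expr0 divr1; apply; first by exists (1 - h ^+ m.-1).
apply: vpos_exp => //.
have : vpos (pl_ring t) (pl_eval t h * pl_eval t (1 - h ^+ m.-1)).
  rewrite -rmorphM mulrBr mulr1 -exprS prednK ?(ltnW m1) // rmorphB rmorphXn
    -opprB.
  by apply: vposN => //; apply: residueT => //; exists h.
by move=> /(vposM vr)[] // /(_ hh).
Qed.

Lemma split_unit w j : S w -> exists u k,
  [/\ S u, S k, S ((d^-1)%:P ^+ j * (w * u) ^+ N)
    & (1 - u) * d%:P ^+ j = w ^+ N * k].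
Proof.
move=> Sw; elim: j => [|j [u [k [Su Sk Sh e]]]].
  exists 1, 0; split; rewrite ?expr0 ?subrr ?mul0r ?mulr0 ?mulr1 ?mul1r //.
  - exact: integral_at1.
  - exact: integral_at0.
  - exact: integral_atX.
pose h : {poly K} := (d^-1)%:P ^+ j * (w * u) ^+ N; rewrite -/h in Sh.
(* Expanding [(1 - u (1 - h^(m-1))) d^(j+1)] gives [d (1 - u) d^j + d u h^(m-2) (h d^j)], where
   [h d^j = (w u)^N]; factoring out [w^N] yields the new [k]. *)
exists (u * (1 - h ^+ m.-1)), (d%:P * k + d%:P * (u ^+ N.+1 * h ^+ m.-2)).
split.
- by apply: integral_atM => //; apply: integral_atB;
  [exact: integral_at1 | exact: integral_atX].
- apply: integral_atD; apply: integral_atM => //.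
  by apply: integral_atM; apply: integral_atX.
- exact: split_step.
- have -> : (1 - u * (1 - h ^+ m.-1)) * d%:P ^+ j.+1 =
     d%:P * ((1 - u) * d%:P ^+ j) + d%:P * u * h ^+ m.-2 * (h * d%:P ^+ j).
    have -> : h ^+ m.-1 = h * h ^+ m.-2.
      by rewrite -exprS prednK //; case: (m) m1 => [|[]].
    by rewrite exprS; ring.
  have -> : h * d%:P ^+ j = (w * u) ^+ N.
    rewrite /h mulrAC -exprMn -polyCM mulVf // expr1n mul1r //.
  by rewrite e [(w * u) ^+ N]exprMn exprS; ring.
Qed.

Hypothesis fieldT : forall t, T t -> forall g, pl_eval t g != 0 ->
  range (pl_eval t) (pl_eval t g)^-1.

(* The binary form [X^m - X Y^(m-1) + Y^m] has no nontrivial zero in the      *)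
(* residue fields, so its value has [m] times the smaller valuation.          *)
Lemma norm_form_min t (Tt : T t) f g : vpos (pl_ring t) (pl_mor t d) ->
  let w' := pl_eval t (f ^+ m - f * g ^+ m.-1 + g ^+ m) in
  vle (pl_ring t) w' (pl_eval t f ^+ m) /\
  vle (pl_ring t) w' (pl_eval t g ^+ m).
Proof.
move=> hd w'; rewrite /w' rmorphD rmorphB rmorphM !rmorphXn; have vr := vrT Tt.
set a := pl_eval t f; set b := pl_eval t g.
have red c x : vle (pl_ring t) c x -> forall e, vle (pl_ring t) e 1 ->
    vle (pl_ring t) (c ^+ m * e) (x ^+ m).
  by move=> h e he; rewrite -[x ^+ m]mulr1; apply: vleM => //; apply: vleX.
have [b0|b0] := eqVneq b 0; last first.
  case: (pselect (vle (pl_ring t) b a)) => hba.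
    pose x := a / b.
    have -> : a ^+ m - a * b ^+ m.-1 + b ^+ m = b ^+ m * (1 + (x ^+ m - x)).
      rewrite /x expr_div_n -[in b ^+ m](prednK (ltnW m1)) !exprS; field.
      by rewrite b0 expf_neq0.
    have hx : vle (pl_ring t) (1 + (x ^+ m - x)) 1.
      apply: vpos_unitD => //; first exact: vle_refl.
      apply: residueT => //; last exact/(vle_div _ _ b0).
      by have [g' _ e] := fieldT Tt b0; exists (f * g') => //;
        rewrite rmorphM e.
    by split; apply: red => //; exact: vle_refl.
  (* Here [x = b / a] is positive, so [x^m] and [x^(m-1)] both are, the latter because [m > 1]. *)
  have a0 : a != 0 by apply: contra_notN hba => /eqP ->; exact: vle0.
  pose x := b / a.
  have hx : vpos (pl_ring t) x.
    by apply: vpos_div => // h; apply: hba.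
  have Wx := vposP vr hx.
  have -> : a ^+ m - a * b ^+ m.-1 + b ^+ m =
    a ^+ m * (1 + (x ^+ m - x ^+ m.-1)).
    rewrite /x !expr_div_n -[in a ^+ m](prednK (ltnW m1)) !exprS; field.
    by rewrite a0 expf_neq0.
  have hx1 : vle (pl_ring t) (1 + (x ^+ m - x ^+ m.-1)) 1.
    apply: vpos_unitD => //; first exact: vle_refl.
    apply: vposB => //; apply: vpos_exp => //; first exact: ltnW.
    by case: (m) m1 => [|[]].
  split; apply: red => //; first exact: vle_refl.
  by case: (vle_total vr b a).
have -> : a ^+ m - a * b ^+ m.-1 + b ^+ m = a ^+ m.
  rewrite b0 !expr0n.
  by case: (m) m1 => [|[|m']] //= _; rewrite mulr0 subr0 addr0.
split; first exact: vle_refl.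
by apply: (@vleX _ _ vr m a b); rewrite b0; exact: vle0.
Qed.

(** Nesting the binary form gives a form [w] of degree [M] in the [a i]. The cofactors [c i] are
    forms of degree [M - 1], which is what the lower bound on their values records. *)
Lemma norm_form (a : nat -> {poly K}) n : exists M w (c : nat -> {poly K}),
  [/\ (0 < M)%N, w = \sum_(i < n) a i * c i,
      forall t, T t -> forall x,
        (forall i, (i < n)%N -> vle (pl_ring t) x (pl_eval t (a i))) ->
        forall i, (i < n)%N -> vle (pl_ring t) (x ^+ M.-1) (pl_eval t (c i))
    & forall t, T t -> vpos (pl_ring t) (pl_mor t d) ->
        forall i, (i < n)%N ->
        vle (pl_ring t) (pl_eval t w) (pl_eval t (a i) ^+ M)].
Proof.
elim: n => [|n [M [w [c [M0 ew h1 h2]]]]].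
  by exists 1%N, 0, (fun=> 0); split => //; rewrite big_ord0.
pose b := a n ^+ M.
(* The binary form is taken at [w] and [b = a n ^+ M], both of degree [M]. Its part
   [w^m - w b^(m-1)] is divisible by [w], so it is redistributed over the old cofactors; [b^m] gives
   the cofactor of [a n]. *)
exists (M * m)%N, (w ^+ m - w * b ^+ m.-1 + b ^+ m),
  (fun i => if (i < n)%N then c i * (w ^+ m.-1 - b ^+ m.-1)
            else a n ^+ (M * m).-1).
have Mm : (0 < M * m)%N by rewrite muln_gt0 M0 ltnW.
split=> //.
- rewrite big_ord_recr /= ltnn -exprS prednK // exprM; congr (_ + _).
  under eq_bigr => i _ do rewrite ltn_ord mulrA.
  by rewrite -mulr_suml -ew mulrBr -exprS prednK // ltnW.
- move=> t Tt x hx; have vr := vrT Tt.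
  have hx' i : (i < n)%N -> vle (pl_ring t) x (pl_eval t (a i)).
    by move=> hi; apply: hx; rewrite ltnS ltnW.
  have hw : vle (pl_ring t) (x ^+ M) (pl_eval t w).
    rewrite ew rmorph_sum; apply: vle_sum => // i _.
    by rewrite rmorphM -(prednK M0) exprS; apply: vleM => //;
      [apply: hx' | apply: h1].
  have hb : vle (pl_ring t) (x ^+ M) (pl_eval t (a n) ^+ M).
    by apply: vleX => //; apply: hx.
  move=> i hi; case: ifP => hin.
    have -> : (M * m).-1 = (M.-1 + M * m.-1)%N.
      by case: (M) M0 => // M' _; case: (m) m1 => // m' _; rewrite mulnS /=;
        lia.
    rewrite exprD rmorphM; apply: vleM => //; first exact: h1.
    rewrite rmorphB !rmorphXn; by apply: vleB => //; rewrite exprM; apply: vleX.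
  by rewrite rmorphXn; apply: vleX => //; apply: hx.
- move=> t Tt hd i hi; have vr := vrT Tt.
  have [l1 l2] := norm_form_min Tt w b hd.
  rewrite ltnS leq_eqVlt in hi; case/orP: hi => [/eqP ->|hi].
    by move: l2; rewrite /b rmorphXn -exprM.
  by apply: (vle_trans vr l1); rewrite exprM; apply: vleX => //; apply: h2.
Qed.

Lemma invertible_of_const (n : nat) (a c : nat -> {poly K}) :
  (forall i, (i < n)%N -> S (a i)) -> (forall i, (i < n)%N -> S (c i)) ->
  \sum_(i < n) c i * a i = d%:P ->
  exists y : nat -> {poly K}, \sum_(i < n) y i * a i = 1 /\
    forall i j, (i < n)%N -> (j < n)%N -> S (y i * a j).
Proof.
move=> Sa Sc e.
have [M [w [b [M0 ew h1 h2]]]] := norm_form a n.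
have Sb i : (i < n)%N -> S (b i).
  move=> hi t Tt; have vr := vrT Tt; apply/vle1; rewrite -(expr1n _ M.-1).
  by apply: h1 => // k hk; apply/vle1/Sa.
have Sw : S w.
  by rewrite ew; apply: integral_at_sum => i _; apply: integral_atM; auto.
have [u [k [Su Sk Sh euk]]] := split_unit (M * N) Sw.
pose D := (d^-1)%:P : {poly K}.
have Dd : D * d%:P = 1 by rewrite -polyCM mulVf.
(* Multiplied by [a i] and summed, the first terms give [k w^N / d^(MN) = 1 - u] and the second ones
   give [u]. *)
exists (fun i => D ^+ (M * N) * (k * b i * w ^+ N.-1) + D * (u * c i)); split.
  under eq_bigr => i _ do rewrite mulrDl.
  rewrite big_split /=.
  have -> : \sum_(i < n) D ^+ (M * N) * (k * b i * w ^+ N.-1) * a i = 1 - u.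
    rewrite (eq_bigr (fun i : 'I_n =>
      D ^+ (M * N) * k * w ^+ N.-1 * (a i * b i)));
      last by move=> i _; ring.
    rewrite -mulr_sumr -ew -mulrA -exprSr prednK // -mulrA [k * _]mulrC -euk.
    by rewrite mulrCA -exprMn Dd expr1n mulr1.
  rewrite (eq_bigr (fun i : 'I_n => D * u * (c i * a i)));
    last by move=> i _; ring.
  by rewrite -mulr_sumr e mulrAC Dd mul1r subrK.
move=> i j hi hj t Tt; have vr := vrT Tt.
have jd0 : pl_mor t d != 0 by rewrite fmorph_eq0.
have jD : pl_eval t D = (pl_mor t d)^-1 by rewrite pl_evalC fmorphV.
case: (pselect (vpos (pl_ring t) (pl_mor t d))) => [hd|/contrapT hd];
  last first.
  have WD : pl_ring t (pl_eval t D).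
    by rewrite jD -[X in pl_ring t X]mul1r; apply/(vle_div _ _ jd0).
  rewrite rmorphM; apply: vrM => //; last exact: Sa.
  rewrite rmorphD; apply: vrD => //; rewrite rmorphM; apply: vrM => //.
  - by rewrite rmorphXn; apply: vrX.
  - by apply: (integral_atM (integral_atM Sk (Sb i hi)) (integral_atX _ Sw)).
  - by apply: (integral_atM Su (Sc i hi)).
(* For [a l] of smallest value, [v w <= M v(a l) <= v(b i) + v(a j)], so [w] divides [b i * a j],
   and [k w^N = (1 - u) d^(MN)] absorbs the denominator. *)
rewrite mulrDl rmorphD; apply: vrD => //.
  rewrite -mulrA rmorphM rmorphXn jD exprVn mulrC; apply/vle_div;
    first by rewrite expf_neq0.
  have [l ln hl] := exists_min_value vr (fun i =>
    pl_eval t (a i)) (leq_ltn_trans (leq0n _) hi).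
  have hw : vle (pl_ring t) (pl_eval t w) (pl_eval t (b i * a j)).
    apply: (vle_trans vr (h2 t Tt hd l ln)).
    rewrite -(prednK M0) exprSr rmorphM; apply: vleM => //; last exact: hl.
    exact: h1.
  have -> : k * b i * w ^+ N.-1 * a j = k * w ^+ N.-1 * (b i * a j) by ring.
  apply: (@vle_trans _ _ vr (pl_eval t (k * w ^+ N.-1 * w))); last first.
    by rewrite !(rmorphM _ (k * _)); apply: vleMl.
  rewrite -mulrA -exprSr prednK // mulrC -euk rmorphM rmorphXn pl_evalC.
  apply: vle_mulW => //; last exact: vle_refl.
  by apply: integral_atB Tt => //; exact: integral_at1.
(* It suffices that [d] divides [u * a j]. This is checked on [MN]-th powers: [d^(MN)] divides
   [(w u)^N], which divides [(u * a j)^(MN)]. *)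
have -> : D * (u * c i) * a j = D * (c i * (u * a j)) by ring.
rewrite rmorphM jD mulrC; apply/vle_div => //.
rewrite rmorphM; apply: vle_mulW => //; first exact: Sc.
rewrite rmorphM; apply: (@vle_expK _ _ vr (M * N));
  first by rewrite muln_gt0 M0.
apply: (@vle_trans _ _ vr (pl_eval t (w * u) ^+ N)).
  have := Sh t Tt; rewrite rmorphM !rmorphXn jD exprVn mulrC => h.
  by apply/vle_div => //; rewrite expf_neq0.
rewrite [X in vle _ _ X]exprM; apply: vleX => //.
rewrite rmorphM mulrC exprMn; apply: vleM => //; last exact: h2.
rewrite -(prednK M0) exprSr; apply: vle_mulW => //; last exact: vle_refl.
by apply: vrX => //; apply: Su.
Qed.

End Uniform.
End IntegralAt.

Lemma fraction_surj (D : idomainType) (x : {fraction D}) :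
  exists a b : D, b != 0 /\ x = a%:F / b%:F.
Proof.
elim/quotW: x => r; have d0 := denom_ratioP r.
exists (frac r).1, (frac r).2; split => //.
have dF : ((frac r).2)%:F != 0 :> {fraction D} by rewrite tofrac_eq0.
apply: (mulIf dF); rewrite divfK //.
unlock FracField.tofrac; rewrite !piE; apply/eqmodP/eqP => /=.
by rewrite /FracField.mulf !numden_Ratio ?mulf_neq0 ?oner_neq0 // !mulr1 mulrC.
Qed.

Lemma bezout_family (K : fieldType) n (f : nat -> {poly K}) :
  exists g (q u : nat -> {poly K}),
    (forall i, (i < n)%N -> f i = g * q i) /\ g = \sum_(i < n) u i * f i.
Proof.
elim: n => [|n [g [q [u [hq hg]]]]].
  by exists 0, (fun=> 0), (fun=> 0); rewrite big_ord0.
have [[x y] /= e] := Bezoutp g (f n); set h := x * g + y * f n in e.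
have hg' : h %| g by rewrite (eqp_dvdl _ e) dvdp_gcdl.
have hf' : h %| f n by rewrite (eqp_dvdl _ e) dvdp_gcdr.
exists h, (fun i => if (i < n)%N then (g %/ h) * q i else f n %/ h),
  (fun i => if (i < n)%N then x * u i else y); split.
  move=> i; rewrite ltnS leq_eqVlt => /orP[/eqP ->|hi].
    by rewrite ltnn mulrC divpK.
  by rewrite hi mulrA [h * _]mulrC divpK // hq.
rewrite big_ord_recr /= ltnn /h; congr (_ + _).
rewrite hg mulr_sumr; apply: eq_bigr => i _; by rewrite ltn_ord mulrA.
Qed.

(** * From relations with constant value to all finitely generated ideals *)

Section Prufer.
Variables (D : idomainType) (K : fieldType) (emb : {rmorphism D -> K}).
Hypothesis emb_inj : injective emb.
Hypothesis emb_frac : forall x : K, exists a b : D, b != 0 /\ x = emb a / emb b.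
Variable T : place K -> Prop.
Hypothesis vrT : forall t, T t -> is_valuation_ring (pl_ring t).
Hypothesis fieldT : forall t, T t -> forall g, pl_eval t g != 0 ->
  range (pl_eval t) (pl_eval t g)^-1.
Local Notation S := (integral_at T).
Hypothesis SX : S 'X.
Hypothesis SD : forall d : D, S (emb d)%:P.
Hypothesis uniformT : forall d : D, d != 0 -> uniform_at T (emb d).

Lemma clear_denominators (f : {poly K}) :
  exists2 e : D, e != 0 & S ((emb e)%:P * f).
Proof.
elim/poly_ind: f => [|p c [e e0 Se]].
  by exists 1; [exact: oner_neq0 | rewrite mulr0; exact: integral_at0].
have [a [b [b0 ->]]] := emb_frac c.
have ib0 : emb b != 0 by rewrite -(rmorph0 emb) (inj_eq emb_inj).
exists (e * b); first by rewrite mulf_neq0.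
have -> : (emb (e * b))%:P * (p * 'X + (emb a / emb b)%:P) =
    (emb b)%:P * ((emb e)%:P * p) * 'X + (emb e)%:P * (emb a)%:P.
  rewrite mulrDr; congr (_ + _); first by rewrite rmorphM polyCM; ring.
  by rewrite -!polyCM; congr (_%:P); rewrite rmorphM; field.
by apply: integral_atD => //; apply: integral_atM => //; apply: integral_atM.
Qed.

Lemma clear_denominators_family n (f : nat -> {poly K}) :
  exists2 e : D, e != 0 & forall i, (i < n)%N -> S ((emb e)%:P * f i).
Proof.
elim: n => [|n [e e0 he]]; first by exists 1; first exact: oner_neq0.
have [e' e'0 he'] := clear_denominators (f n).
exists (e * e'); first by rewrite mulf_neq0.
move=> i; rewrite ltnS leq_eqVlt rmorphM polyCM => /orP[/eqP ->|hi].
  by rewrite -mulrA; apply: integral_atM.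
by rewrite mulrAC mulrC; apply: integral_atM => //; exact: he.
Qed.

(** Divide the generators by their gcd [g] in [K[X]] to get [q i] with a relation [sum u_i q_i = 1].
    Clearing denominators by [e] and [e'] turns it into a relation in the ring with value [e' e], so
    [invertible_of_const] applies with [d = e' e]. *)
Lemma prufer_integral_at : prufer_domain [set f%:F | f in S].
Proof.
set R := [set _ | _ in _].
have R0 : R 0 by exists 0; [exact: integral_at0 | rewrite tofrac0].
have R1 : R 1 by exists 1; [exact: integral_at1 | rewrite tofrac1].
have RM x y : R x -> R y -> R (x * y).
  by move=> [f Sf <-] [g Sg <-]; exists (f * g);
    [exact: integral_atM | rewrite tofracM].
have RD x y : R x -> R y -> R (x + y).
  by move=> [f Sf <-] [g Sg <-]; exists (f + g);
    [exact: integral_atD | rewrite tofracD].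
have RB x y : R x -> R y -> R (x - y).
  by move=> [f Sf <-] [g Sg <-]; exists (f - g);
    [exact: integral_atB | rewrite tofracB].
split.
  split; first exact/mem_set.
    by move=> x y; rewrite !inE; apply: RB.
  by move=> x y; rewrite !inE; apply: RM.
move=> n a Ra aN0.
(* Such a [y] lies in the inverse ideal, and then [x = sum (x a_i) y_i] for every [x] of the
   ring. *)
have [y [ya1 yaR]] : exists y : 'I_n -> {fraction {poly K}},
    \sum_i y i * a i = 1 /\ forall i j, R (y i * a j).
  have /choice[f0 hf0] : forall i, exists f, S f /\ f%:F = a i.
    by move=> i; have [f Sf e] := Ra i; exists f.
  pose f (i : nat) := oapp f0 0 (insub i).
  have ef (i : 'I_n) : (f i)%:F = a i by rewrite /f valK /=; case: (hf0 i).
  have [g [q [u [fq gu]]]] := bezout_family n f.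
  have g0 : g != 0.
    apply: contra_notN aN0 => /eqP g0; apply/seteqP; split => x.
      move=> [c [_ ->]]; rewrite /= big1 // => i _.
      by rewrite -ef fq // g0 mul0r tofrac0 mulr0.
    by move=> ->; exists (fun=> 0); split => //; rewrite big1 // => i _;
      rewrite mul0r.
  have uq1 : \sum_(i < n) u i * q i = 1.
    apply: (mulfI g0); rewrite mulr1 {2}gu mulr_sumr; apply: eq_bigr => i _.
    by rewrite fq // mulrCA.
  have [e e0 he] := clear_denominators_family n q.
  have [e' e'0 he'] := clear_denominators_family n u.
  have ee0 : e' * e != 0 by rewrite mulf_neq0.
  have [N [m [N0 m1 hu]]] := uniformT ee0.
  have [||||y [y1 y2]] := @invertible_of_const _ T vrT (emb (e'
    * e)) N m _ N0 m1 (SD _) _ _ fieldT n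
     (fun i => (emb e)%:P * q i) (fun i => (emb e')%:P * u i) he he'.
  - by rewrite -(rmorph0 emb) (inj_eq emb_inj).
  - by move=> t Tt hd x hx; case: (hu t Tt hd x hx).
  - by move=> t Tt hd x hx; case: (hu t Tt hd x hx).
  - rewrite (eq_bigr (fun i : 'I_n => (emb e')%:P * (emb e)%:P * (u i * q i))).
      by rewrite -mulr_sumr uq1 mulr1 rmorphM polyCM.
    by move=> i _; ring.
  have gF : g%:F != 0 by rewrite tofrac_eq0.
  have key i j : (j < n)%N ->
    (y i * (emb e)%:P)%:F / g%:F * (f j)%:F = (y i * ((emb e)%:P * q j))%:F.
    move=> hj; rewrite fq // (tofracM g) mulrA divfK // -tofracM;
      by rewrite -mulrA.
  exists (fun i => (y i * (emb e)%:P)%:F / g%:F); split.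
    rewrite -[1]tofrac1 -y1 rmorph_sum; apply: eq_bigr => i _.
    by rewrite -ef key.
  by move=> i j; rewrite -ef key //; eexists; [apply: y2 |].
have Rsum (I : Type) (r : seq I) (P : pred I) (F : I -> _) :
    (forall i, P i -> R (F i)) -> R (\sum_(i <- r | P i) F i).
  by move=> h; apply: (big_ind R).
apply/seteqP; split=> x.
  move=> [k [b [c [hb hc ->]]]]; apply: Rsum => i _; rewrite mulrC; exact: hc.
move=> Rx; exists n, (fun i => x * a i), y; split.
- move=> i; exists (fun k => if k == i then x else 0); split.
    by move=> k; case: ifP.
  rewrite (bigD1 i) //= eqxx big1 ?addr0 // => k /negbTE ->; exact: mul0r.
- move=> i z [c [hc ->]]; rewrite mulr_sumr; apply: Rsum => k _.
  by rewrite mulrCA; apply: RM.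
- rewrite -[LHS]mulr1 -ya1 mulr_sumr; apply: eq_bigr => i _; ring.
Qed.

End Prufer.

(** * Integral closure as an intersection of valuation rings *)

(** [Zorn_bigcup] also demands the union of the empty chain, which is neither an ideal nor a
    subring. So [set0] is adjoined to [P]; should it come out as maximal, every member of [P] is
    empty and [A0] serves. *)
Lemma Zorn_nonempty (T : Type) (P : set (set T)) :
  (exists A, P A) ->
  (forall F : set (set T), F `<=` P -> total_on F subset ->
     (exists A, F A) -> P (\bigcup_(X in F) X)) ->
  exists2 A, P A & forall B, A `<=` B -> P B -> B `<=` A.
Proof.
move=> [A0 PA0] hF.
pose P' : set (set T) := [set A | A = set0 \/ P A].
have [|A [P'A maxA]] := @Zorn_bigcup T P'.
  move=> F FP' totF.
  pose G := F `&` P.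
  have [[A GA]|nG] := pselect (exists A, G A).
    right; have -> : \bigcup_(X in F) X = \bigcup_(X in G) X.
      apply/seteqP; split=> x [X FX Xx].
        by exists X => //; split => //; case: (FP' X FX) => // X0; move: Xx;
          rewrite X0.
      by exists X => //; case: FX.
    apply: hF; [by move=> X [] | | by exists A].
    by move=> X Y [FX _] [FY _]; apply: totF.
  left; apply/seteqP; split=> // x [X FX Xx]; case: (FP' X FX) => [X0|PX].
    by move: Xx; rewrite X0.
  by case: nG; exists X.
have maxA' B : A `<=` B -> P B -> B `<=` A.
  move=> AB PB; apply: contrapT => BA; apply: (maxA B); first by split.
  by right.
case: P'A => [A0E|PA]; last by exists A.
exists A0 => // B A0B PB; apply: (subset_trans (maxA' B _ PB)); by rewrite A0E.
Qed.

Definition is_subring (L : nzRingType) (R : set L) :=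
  [/\ R 1, forall x y, R x -> R y -> R (x - y)
    & forall x y, R x -> R y -> R (x * y)].

Section Subring.
Variables (L : nzRingType) (R : set L).
Hypothesis srR : is_subring R.

Lemma sr0 : R 0.
Proof. by case: srR => h1 hB _; rewrite -(subrr 1); apply: hB. Qed.
Lemma srN x : R x -> R (- x).
Proof. by case: srR => _ hB _ Rx; rewrite -sub0r; apply: hB => //;
  exact: sr0. Qed.
Lemma srD x y : R x -> R y -> R (x + y).
Proof. by case: srR => _ hB _ Rx Ry; rewrite -[y]opprK; apply: hB => //;
  exact: srN. Qed.
Lemma srX n x : R x -> R (x ^+ n).
Proof.
by case: srR => h1 _ hM Rx; elim: n => [|n IH]; rewrite ?expr0 // exprS;
  apply: hM.
Qed.
Lemma sr_sum (I : Type) (r : seq I) (P : pred I) (F : I -> L) :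
  (forall i, P i -> R (F i)) -> R (\sum_(i <- r | P i) F i).
Proof. by move=> h; apply: (big_ind R) => //; [exact: sr0 | exact: srD]. Qed.
End Subring.

Lemma subring_bigcup (L : nzRingType) (F : set (set L)) :
  (forall R, F R -> is_subring R) -> total_on F subset -> (exists R, F R) ->
  is_subring (\bigcup_(X in F) X).
Proof.
move=> hF totF [R0 FR0].
have join x y : (\bigcup_(X in F) X) x -> (\bigcup_(X in F) X) y ->
    exists2 R, F R & R x /\ R y.
  move=> [X FX Xx] [Y FY Yy]; case: (totF X Y FX FY) => h.
    by exists Y => //; split => //; exact: h.
  by exists X => //; split => //; exact: h.
split.
- by exists R0 => //; case: (hF R0 FR0).
- by move=> x y hx hy; have [R FR [Rx Ry]] := join x y hx hy; exists R => //;
  case: (hF R FR) => _ h _; apply: h.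
- by move=> x y hx hy; have [R FR [Rx Ry]] := join x y hx hy; exists R => //;
  case: (hF R FR) => _ _; apply.
Qed.

Definition adjoin (L : nzRingType) (R : set L) (z : L) : set L :=
  [set (P : {poly L}).[z] | P in [set P : {poly L} | forall i, R P`_i]].

Lemma adjoin_subring (L : comNzRingType) (R : set L) (z : L) :
  is_subring R -> is_subring (adjoin R z).
Proof.
move=> srR; have [R1 RB RM] := srR; split.
- exists 1; last by rewrite hornerC.
  by move=> i; rewrite coef1; case: (i == 0)%N => //; exact: sr0.
- move=> _ _ [P hP <-] [Q hQ <-]; exists (P - Q);
  last by rewrite hornerD hornerN.
  by move=> i; rewrite coefB; apply: RB.
- move=> _ _ [P hP <-] [Q hQ <-]; exists (P * Q); last by rewrite hornerM.
  by move=> i; rewrite coefM; apply: sr_sum => // k _; apply: RM.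
Qed.

Lemma sub_adjoin (L : nzRingType) (R : set L) (z : L) :
  is_subring R -> R `<=` adjoin R z.
Proof.
move=> srR c Rc; exists c%:P; last by rewrite hornerC.
by move=> i; rewrite coefC; case: (i == 0)%N => //; exact: sr0.
Qed.

Lemma mem_adjoin (L : nzRingType) (R : set L) (z : L) :
  is_subring R -> adjoin R z z.
Proof.
move=> srR; exists 'X; last by rewrite hornerX.
by move=> i; rewrite coefX; case: (i == 1)%N; [case: srR | exact: sr0].
Qed.

(** * Subrings maximal among those avoiding [x] are valuation rings *)

Section Chevalley.
Variables (L : fieldType) (W : set L) (x : L).
Hypothesis srW : is_subring W.
Hypothesis x0 : x != 0.
Hypothesis Wy : W x^-1.
Hypothesis Wx : ~ W x.
Hypothesis maxW : forall R, W `<=` R -> is_subring R -> ~ R x -> R `<=` W.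

(** Inverting [e = 1 - r / x] does not bring in [x]: as [e^k = 1 - b / x] with [b] in [W], an
    equation [x e^k = a] would give [x = a + b]. By maximality [W] already contains [e^-1]. *)
Lemma maximal_jacobson r : W r -> 1 - r / x != 0 /\ W (1 - r / x)^-1.
Proof.
move=> Wr; have [W1 WB WM] := srW; set e := 1 - r / x.
have We : W e by apply: WB => //; apply: WM.
have e0 : e != 0.
  rewrite subr_eq0 eq_sym; apply/eqP => h; apply: Wx.
  by rewrite -[x]mul1r -h divfK.
split=> //.
pose R : set L := [set z | exists a k, W a /\ z = a / e ^+ k].
have srR : is_subring R.
  split.
  - by exists 1, 0%N; split => //; rewrite expr0 divr1.
  - move=> _ _ [a [k [Wa ->]]] [b [l [Wb ->]]];
    exists (a * e ^+ l - b * e ^+ k), (k + l)%N.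
    split; first by apply: WB; apply: WM => //; apply: srX.
    by rewrite exprD; field; rewrite !expf_neq0.
  - move=> _ _ [a [k [Wa ->]]] [b [l [Wb ->]]]; exists (a * b), (k + l)%N.
    split; first exact: WM.
    by rewrite exprD; field; rewrite !expf_neq0.
apply: (maxW (R := R)) => //.
- by move=> a Wa; exists a, 0%N; split => //; rewrite expr0 divr1.
- move=> [a [k [Wa xa]]].
  have [b Wb eb] : exists2 b, W b & e ^+ k = 1 - b / x.
    elim: (k) => [|l [b Wb eb]]; first by exists 0;
      [exact: sr0 | rewrite expr0 mul0r subr0].
    exists (b + r * e ^+ l); last by rewrite exprS {1}/e eb; ring.
    by apply: srD => //; apply: WM => //; apply: srX.
  apply: Wx; have -> : x = a + b; last exact: srD.
  have xe : x * e ^+ k = a by rewrite {1}xa divfK // expf_neq0.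
  by rewrite -xe eb; field.
- by exists 1, 1%N; split => //; rewrite expr1 div1r.
Qed.

(* Lowers the degree of a representation of [x] in [W[z]] by means of one in  *)
(* [W[1/z]] of no larger degree.                                              *)
Lemma adjoin_descent (z : L) (P Q : {poly L}) n : z != 0 ->
  (forall i, W P`_i) -> (forall i, W Q`_i) ->
  (size P <= n.+1)%N -> (size Q <= n.+1)%N ->
  x = P.[z] -> x = Q.[z^-1] ->
  exists P' : {poly L}, [/\ forall i, W P'`_i, (size P' <= n)%N & x = P'.[z]].
Proof.
move=> z0 hP hQ sP sQ eP eQ; have [W1 WB WM] := srW.
have [e0 We] := maximal_jacobson (hQ 0%N); set e := 1 - _ in e0 We.
(* With [e = 1 - Q_0 / x], the equation [x = Q(1/z)] gives [e x = sum_(i > 0) Q_i z^(-i)].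
   Multiplying by [P_n z^n / (e x)] rewrites the top term of [P] in lower powers of [z]. *)
exists (\poly_(k < n) (P`_k + P`_n * (e^-1 * x^-1 * Q`_(n - k)))); split.
- move=> i; rewrite coef_poly; case: ifP => _; last exact: sr0.
  by apply: srD => //; apply: (WM _ _ (hP _)); apply: (WM _ _ (WM _ _ We Wy)).
- exact: size_poly.
rewrite horner_poly.
under eq_bigr => k _ do rewrite mulrDl.
rewrite big_split /= {1}eP (horner_coef_wide _ sP) big_ord_recr /=;
  congr (_ + _).
under eq_bigr => k _ do rewrite -[P`_n * _ * _]mulrA.
rewrite -mulr_sumr; congr (_ * _).
under eq_bigr => k _ do rewrite -[_ * Q`_(n - k) * _]mulrA.
rewrite -mulr_sumr.
have zk (k : 'I_n) : z ^+ k = z ^+ n * z^-1 ^+ (n - k).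
  have -> : z ^+ n = z ^+ k * z ^+ (n - k) by rewrite -exprD subnKC // ltnW.
  by rewrite exprVn mulfK // expf_neq0.
under eq_bigr => k _ do rewrite zk mulrCA.
rewrite -mulr_sumr.
have -> : \sum_(k < n) Q`_(n - k) * z^-1 ^+ (n - k) = x - Q`_0.
  rewrite {1}eQ (horner_coef_wide _ sQ) big_ord_recl /= expr0 mulr1
    [RHS]addrAC subrr add0r.
  rewrite (reindex_inj rev_ord_inj) /=; apply: eq_bigr => k _.
  by rewrite /bump /= add1n subKn.
by rewrite /e; field; rewrite x0 /= subr_eq0; apply/eqP => h; apply: Wx;
  rewrite h.
Qed.

(** Infinite descent on the total size of the two representations, exchanging [z] and [z^-1] so that
    the longer one is shortened. *)
Lemma adjoin_inverse (z : L) : z != 0 -> adjoin W z x -> adjoin W z^-1 x ->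
  False.
Proof.
move=> z0 [P hP eP] [Q hQ eQ].
have : (size P + size Q <= size P + size Q)%N by [].
move: {2}(_ + _)%N => n;
  elim: n z z0 P Q hP eP hQ eQ => [|n IH] z z0 P Q hP eP hQ eQ.
  rewrite leqn0 addn_eq0 size_poly_eq0 => /andP[/eqP P0 _].
  by case/eqP: x0; rewrite -eP P0 horner0.
wlog sQP : z z0 P Q hP eP hQ eQ / (size Q <= size P)%N.
  move=> h sn; case/orP: (leq_total (size P) (size Q)) => hs;
    last exact: (h z z0 P Q).
  apply: (h z^-1 _ Q P) => //; first by rewrite invr_eq0.
    by rewrite invrK.
  by rewrite addnC.
case sP : (size P) => [|k].
  by move/eqP: sP; rewrite size_poly_eq0 => /eqP P0; case/eqP: x0;
    rewrite -eP P0 horner0.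
move=> hn.
have [||P' [hP' sP' eP']] :=
  @adjoin_descent z P Q k z0 hP hQ _ _ (esym eP) (esym eQ).
- by rewrite sP.
- by rewrite -sP.
apply: (IH z z0 P' Q) => //.
by apply: leq_trans (leq_add sP' (leqnn _)) _; rewrite -ltnS -addSn.
Qed.

Lemma maximal_valuation_ring : is_valuation_ring W.
Proof.
have [W1 WB WM] := srW; split => // z.
have [->|z0] := eqVneq z 0; first by left; exact: sr0.
apply: contrapT => /not_orP [nz nzV]; apply: (adjoin_inverse z0).
  apply: contrapT => h; apply: nz; apply: (maxW (R := adjoin W z)) => //.
  - exact: sub_adjoin.
  - exact: adjoin_subring.
  - exact: mem_adjoin.
apply: contrapT => h; apply: nzV; apply: (maxW (R := adjoin W z^-1)) => //.
- exact: sub_adjoin.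
- exact: adjoin_subring.
- exact: mem_adjoin.
Qed.

End Chevalley.

Lemma integral_of_inverse (D : comNzRingType) (L : fieldType) (j : {rmorphism
  D -> L})
    (x : L) (p : {poly D}) : x != 0 -> x = (map_poly j p).[x^-1] ->
      integralOver j x.
Proof.
move=> x0; rewrite horner_poly; set n := size p => e.
exists ('X^(n.+1) - \sum_(i < n) p`_i *: 'X^(n - i)).
  rewrite monicE lead_coefDl ?lead_coefXn //.
  rewrite size_polyXn size_polyN; apply: leq_ltn_trans (size_sum _ _ _) _.
  rewrite ltnS; apply/bigmax_leqP => i _.
  by apply: leq_trans (size_scale_leq _ _) _; rewrite size_polyXn ltnS leq_subr.
rewrite /root rmorphB rmorph_sum /= map_polyXn hornerD hornerN hornerXn
  horner_sum.
rewrite subr_eq0 exprS {1}e mulr_suml; apply/eqP/eq_bigr => i _.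
rewrite map_polyZ map_polyXn hornerZ hornerXn -mulrA; congr (_ * _).
have -> : x ^+ n = x ^+ i * x ^+ (n - i) by rewrite -exprD subnKC // ltnW.
by rewrite exprVn mulrA mulVf ?mul1r // expf_neq0.
Qed.

(** If [x] is not integral, it is not in the ring generated by [x^-1] over the image of [D]. Zorn
    then gives a subring maximal among those containing that ring but not [x]. *)
Lemma exists_valuation_ring (D : comNzRingType) (L : fieldType)
    (j : {rmorphism D -> L}) (x : L) : ~ integralOver j x ->
  exists W : set L, [/\ is_valuation_ring W, forall d, W (j d) & ~ W x].
Proof.
move=> nx.
have x0 : x != 0.
  apply: contra_notN nx => /eqP ->; exists 'X; first exact: monicX.
  by rewrite map_polyX rootX.
have srD : is_subring (range j).
  split; first by exists 1; rewrite ?rmorph1.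
    by move=> _ _ [a _ <-] [b _ <-]; exists (a - b); rewrite ?rmorphB.
  by move=> _ _ [a _ <-] [b _ <-]; exists (a * b); rewrite ?rmorphM.
pose good (R : set L) := [/\ is_subring R, forall d, R (j d), R x^-1 & ~ R x].
have [||W [srW WD Wy Wx] maxW] := @Zorn_nonempty L good.
- exists (adjoin (range j) x^-1); split; first exact: adjoin_subring.
  + by move=> d; apply: sub_adjoin => //; exists d.
  + exact: mem_adjoin.
  + move=> [P hP e]; apply: nx.
    have /choice[f hf] : forall i : nat, exists d, j d = P`_i.
      by move=> i; have [d _ <-] := hP i; exists d.
    apply: (@integral_of_inverse _ _ j x (\poly_(i < size P) f i)) => //.
    rewrite -[LHS]e; congr (_.[_]); apply/polyP => i.
    rewrite coef_map coef_poly; case: ltnP => h; first exact: esym (hf i).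
    by rewrite nth_default //; symmetry; exact: rmorph0.
- move=> F hF totF [R0 FR0]; split.
  + by apply: subring_bigcup => //; [move=> R /hF[] | exists R0].
  + by move=> d; exists R0 => //; case: (hF R0 FR0).
  + by exists R0 => //; case: (hF R0 FR0).
  + by move=> [R FR Rx]; case: (hF R FR).
exists W; split=> //; apply: (maximal_valuation_ring srW x0 Wy Wx).
move=> R WR srR nRx; apply: maxW => //; split => //; last exact: WR.
by move=> d; apply: WR.
Qed.

Lemma integralP (D : comNzRingType) (L : fieldType) (j : {rmorphism D ->
  L}) (x : L) :
  integralOver j x <->
  forall W : set L, is_valuation_ring W -> (forall d, W (j d)) -> W x.
Proof.
split=> [[p mp px] W vrW WD|h].
  apply: (integral_in_vr vrW _ _ px); first exact: monic_map.
  by move=> i; rewrite coef_map; exact: WD.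
apply: contrapT => /exists_valuation_ring [W [vrW WD]]; apply; exact: h.
Qed.

(** * Almost Dedekind domains *)

Lemma ideal_closedP (D : idomainType) (I : set D) :
  idealr_closed [in I] <->
  [/\ I 0, ~ I 1 & forall a u v, I u -> I v -> I (a * u + v)].
Proof.
split=> [[I0 I1 IM]|[I0 I1 IM]].
  split; first by rewrite inE in I0.
    by move=> h; case/negP: I1; rewrite inE.
  by move=> a u v Iu Iv; have := IM a u v; rewrite !inE => /(_ Iu Iv).
split; first by rewrite inE.
  by apply/negP; rewrite inE.
by move=> a u v; rewrite !inE; apply: IM.
Qed.

Section Ideal.
Variables (D : idomainType) (I : set D).
Hypothesis idI : idealr_closed [in I].

Lemma ideal0 : I 0. Proof. by case/ideal_closedP: idI. Qed.
Lemma ideal1 : ~ I 1. Proof. by case/ideal_closedP: idI. Qed.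
Lemma idealM a u : I u -> I (a * u).
Proof. by case/ideal_closedP: idI => I0 _ h Iu; rewrite -[_ * _]addr0;
  apply: h. Qed.
Lemma idealD u v : I u -> I v -> I (u + v).
Proof. by case/ideal_closedP: idI => _ _ h Iu Iv; rewrite -[u]mul1r;
  apply: h. Qed.
Lemma idealB u v : I u -> I v -> I (u - v).
Proof. by move=> Iu Iv; rewrite -mulN1r; apply: idealD => //;
  apply: idealM. Qed.
Lemma ideal_sum (J : Type) (r : seq J) (P : pred J) (F : J -> D) :
  (forall i, P i -> I (F i)) -> I (\sum_(i <- r | P i) F i).
Proof. by move=> h; apply: (big_ind I) => //;
  [exact: ideal0 | exact: idealD]. Qed.
End Ideal.

Section MaximalIdeals.
Variable D : idomainType.
Implicit Types (I M P : set D).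

Lemma exists_maximal I : idealr_closed [in I] ->
  exists2 M, maximal_ideal M & I `<=` M.
Proof.
move=> idI.
have [||M [idlM IM] maxM] := @Zorn_nonempty D
    [set J : set D | idealr_closed [in J] /\ I `<=` J].
- by exists I; split.
- move=> F hF totF [J0 FJ0]; split; last first.
    by move=> x Ix; exists J0 => //; apply: (hF J0 FJ0).2.
  apply/ideal_closedP; split.
  + by exists J0 => //; apply: ideal0; case: (hF _ FJ0).
  + by move=> [J FJ]; apply: ideal1; case: (hF _ FJ).
  + move=> a u v [J FJ Ju] [J' FJ' Jv].
    have idJ := (hF _ FJ).1; have idJ' := (hF _ FJ').1.
    case: (totF J J' FJ FJ') => h.
      by exists J' => //; apply: idealD => //; apply: idealM => //; apply: h.
    by exists J => //; apply: idealD => //; [apply: idealM | apply: h].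
exists M => //; split => // J idJ MJ; apply/seteqP; split => //.
by apply: maxM => //; split => //; apply: subset_trans IM MJ.
Qed.

Section Max.
Variable M : set D.
Hypothesis maxM : maximal_ideal M.
Let idealM_closed : idealr_closed [in M] := maxM.1.

Lemma maximal_unit_mod s : ~ M s -> exists s', M (1 - s * s').
Proof.
move=> Ms; apply: contrapT => h.
pose J : set D := [set x | exists r, M (x - s * r)].
have idJ : idealr_closed [in J].
  apply/ideal_closedP; split.
  - by exists 0; rewrite mulr0 subr0; exact: ideal0.
  - by move=> [r hr]; apply: h; exists r.
  - move=> a u v [r hr] [t ht]; exists (a * r + t).
    have -> : a * u + v - s * (a * r + t) =
      a * (u - s * r) + (v - s * t) by ring.
    by apply: idealD => //; apply: idealM.
have MJ : M `<=` J by move=> x Mx; exists 0; rewrite mulr0 subr0.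
apply: Ms; rewrite -(maxM.2 J idJ MJ); exists 1; rewrite mulr1 subrr;
  exact: ideal0.
Qed.

Lemma maximal_primeP u v : M (u * v) -> M u \/ M v.
Proof.
move=> Muv; case: (pselect (M u)) => Mu; [by left | right].
have [s hs] := maximal_unit_mod Mu.
have -> : v = v * (1 - u * s) + s * (u * v) by ring.
by apply: idealD => //; apply: idealM.
Qed.

Lemma maximal_prime : prime_ideal M.
Proof.
split=> // u v; rewrite !inE => /maximal_primeP h; apply/orP.
by case: h => h; [left | right]; rewrite inE.
Qed.

Variable v : {fraction D} -> int.
Hypothesis adv : adic_valuation M v.

Lemma adicM x y : x != 0 -> y != 0 -> v (x * y) = v x + v y.
Proof. by case: adv => -[h _ _ _]; apply: h. Qed.

Lemma adic1 : v 1 = 0.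
Proof.
have := adicM (oner_neq0 _) (oner_neq0 _); rewrite mulr1 => h.
by apply: (addIr (v 1)); rewrite add0r -h.
Qed.

Lemma adicV x : x != 0 -> v x^-1 = - v x.
Proof.
move=> x0; have xV : x^-1 != 0 by rewrite invr_eq0.
by have := adicM x0 xV; rewrite divff // adic1 => /esym/eqP;
  rewrite addrC addr_eq0 => /eqP.
Qed.

Lemma adicX n x : x != 0 -> v (x ^+ n) = v x * n%:Z.
Proof.
move=> x0; elim: n => [|n IH]; first by rewrite expr0 adic1 mulr0.
by rewrite exprS adicM ?expf_neq0 // IH -{1}[v x]mulr1 -mulrDr -intS.
Qed.

Lemma adic_localization x : localization M x <-> x = 0 \/ 0 <= v x.
Proof. by case: adv => _ ->. Qed.

Lemma adic_ge0 d : d != 0 -> 0 <= v d%:F.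
Proof.
move=> d0; have /adic_localization[] // : localization M d%:F.
  by exists d, 1; split; [exact: ideal1 | rewrite tofrac1 divr1].
by move/eqP; rewrite tofrac_eq0 (negbTE d0).
Qed.

Lemma adic_gt0 d : d != 0 -> M d -> 0 < v d%:F.
Proof.
move=> d0 Md; have dF : d%:F != 0 :> {fraction D} by rewrite tofrac_eq0.
rewrite ltNge; apply/negP => h.
have /adic_localization[a [s [Ms e]]] : d%:F^-1 = 0 \/ 0 <= v d%:F^-1.
  by right; rewrite adicV // oppr_ge0.
apply: Ms; have s0 : s%:F != 0 :> {fraction D}.
  by apply: contraNneq dF => s0; rewrite -invr_eq0 e s0 invr0 mulr0.
have -> : s = a * d; last exact: idealM.
apply/eqP; rewrite -tofrac_eq tofracM; apply/eqP.
have -> : a%:F = d%:F^-1 * s%:F by rewrite e divfK.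
by rewrite mulrAC mulVf // mul1r.
Qed.

Lemma adic_eq0 d : ~ M d -> v d%:F = 0.
Proof.
move=> Md; have d0 : d != 0 by apply: contra_notN Md => /eqP->; exact: ideal0.
have dF : d%:F != 0 :> {fraction D} by rewrite tofrac_eq0.
apply/eqP; rewrite eq_le adic_ge0 // andbT -oppr_ge0 -adicV //.
have /adic_localization[/eqP|//] : localization M d%:F^-1.
  by exists 1, d; rewrite tofrac1 div1r.
by rewrite invr_eq0 (negbTE dF).
Qed.

Lemma adic_le_dvd x d : x != 0 -> d != 0 -> v d%:F <= v x%:F ->
  exists s a, ~ M s /\ s * x = a * d.
Proof.
move=> x0 d0 h.
have xF : x%:F != 0 :> {fraction D} by rewrite tofrac_eq0.
have dF : d%:F != 0 :> {fraction D} by rewrite tofrac_eq0.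
have /adic_localization[a [s [Ms e]]] : x%:F / d%:F = 0 \/ 0 <= v (x%:F / d%:F).
  by right; rewrite adicM ?invr_eq0 // adicV // subr_ge0.
exists s, a; split => //.
have sF : s%:F != 0 :> {fraction D}.
  by rewrite tofrac_eq0; apply: contra_notN Ms => /eqP->; exact: ideal0.
apply/eqP; rewrite -tofrac_eq !tofracM; apply/eqP.
by rewrite -[x%:F](divfK dF) e mulrA mulrCA divff // mulr1.
Qed.

End Max.

Hypothesis adD : almost_dedekind D.

Lemma exists_adic M : maximal_ideal M -> exists v, adic_valuation M v.
Proof. by move=> /(adD.2) [v h1 h2]; exists v. Qed.

(** Let [M] be maximal above [P] and [y] in [M]. Some [y^n] has [M]-adic value at least that of [x],
    so [s y^n] is a multiple of [x] with [s] outside [M], and primality puts [y] in [P]. *)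
Lemma nonzero_prime_maximal P x : prime_ideal P -> P x -> x != 0 ->
  maximal_ideal P.
Proof.
move=> [idP prP] Px x0; have [M maxM PM] := exists_maximal idP.
suff -> : P = M by [].
apply/seteqP; split => // y My.
have [v adv] := exists_adic maxM.
have [->|y0] := eqVneq y 0; first exact: ideal0.
have vy := adic_gt0 maxM adv y0 My; have vx := adic_ge0 maxM adv x0.
have yF : y%:F != 0 :> {fraction D} by rewrite tofrac_eq0.
pose n := `|v x%:F|%N.
have [|s [a [Ms e]]] := @adic_le_dvd M maxM v adv (y ^+ n) x (expf_neq0 _ y0)
  x0.
  rewrite tofracXn (adicX adv) // /n -{1}[v x%:F]gez0_abs // -[X in X <=
    _]mul1r.
  by apply: ler_wpM2r => //; rewrite -gtz0_ge1.
have prP' u w : P (u * w) -> P u \/ P w.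
  by move=> h; have := prP u w; rewrite !inE => /(_ h)/orP[]; rewrite inE; auto.
have : P (s * y ^+ n) by rewrite e; apply: idealM.
case/prP'; first by move/PM.
elim: (n) => [|m IH]; first by rewrite expr0 => /(ideal1 idP).
by rewrite exprS => /prP'[].
Qed.

End MaximalIdeals.

(** * Bounds from the double-boundedness condition *)

(** Classes may be repeated, so the size of [s] is only an upper bound for the cardinality of
    [D / M]. *)
Definition residue_reps (D : idomainType) (M : set D) (s : seq D) :=
  forall x, exists2 y, y \in s & M (x - y).

Lemma finite_residue_reps (D : idomainType) (M : set D) :
  idealr_closed [in M] -> finite_set (quotient_set M) ->
    exists s, residue_reps M s.
Proof.
move=> idlM /finite_seqP[s es].
have /choice[r hr] : forall X : set D, exists y, X !=set0 -> X y.
  move=> X; case: (pselect (X !=set0)) => [[y Xy]|h]; first by exists y.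
  by exists 0.
exists (map r s) => x.
pose X : set D := [set y | M (y - x)].
have : X \in s by have : [set` s] X by rewrite -es; exists x.
move=> Xs; exists (r X); first exact: map_f.
rewrite -opprB -mulN1r; apply: idealM => //; apply: (hr X); exists x.
by rewrite /X /= subrr; exact: ideal0.
Qed.

(** * Bounds over a base ring [R] abstracting [int] and [{poly 'F_q}]: Bezout, a size [mu] for
    factorization, infinitely many elements *)

Section BaseRing.
Variables (D : idomainType) (R : comNzRingType) (phi : {rmorphism R -> D}).
Hypothesis phi_inj : injective phi.
Hypothesis bezoutR : forall c x : R, exists g u v c' x' : R,
  [/\ g = u * c + v * x, c = g * c' & x = g * x'].
Variable mu : R -> nat.
Hypothesis mu_lt : forall a b : R, a * b != 0 -> (forall b', b * b' != 1) ->
  (mu a < mu (a * b))%N.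
Variable enumR : nat -> R.
Hypothesis enumR_inj : injective enumR.

Hypothesis adD : almost_dedekind D.
Hypothesis finD : finite_residue_fields D.
Hypothesis dbD : doubly_bounded (range phi).

Lemma phi_eq0 c : (phi c == 0) = (c == 0).
Proof. by rewrite -(rmorph0 phi) (inj_eq phi_inj). Qed.

(** Modulo [p] every element is zero or invertible; units of [R] qualify too. *)
Definition bezout_prime (p : R) :=
  forall x, (exists q, x = p * q) \/ exists u v, u * p + v * x = 1.

Lemma bezout_prime_above p M : bezout_prime p -> maximal_ideal M -> M (phi p) ->
  forall x, M (phi x) -> exists q, x = p * q.
Proof.
move=> pp maxM Mp x Mx; case: (pp x) => // -[u [v e]].
case: (ideal1 maxM.1); rewrite -(rmorph1 phi) -e rmorphD !rmorphM.
by apply: idealD maxM.1 _ _ _ _; apply: idealM maxM.1 _ _ _.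
Qed.

Lemma exists_residue_degree p M : bezout_prime p -> maximal_ideal M ->
  M (phi p) ->
  exists f, residue_degree (range phi) M f.
Proof.
move=> pp maxM Mp; have idlM := maxM.1.
have span_deg n (b : 'I_n -> D) : (forall x, exists c : 'I_n -> R,
    M (x - \sum_i phi (c i) * b i)) -> exists f, residue_degree (range phi) M f.
  elim: n b => [|n IH] b hb.
    exists 0%N, b; split; last by move=> c _ _ [].
    move=> x; have [c hc] := hb x; by exists (fun i => phi (c i));
      split => // i; exists (c i).
  case: (pselect (exists (c : 'I_n.+1 -> R) i0,
      M (\sum_i phi (c i) * b i) /\ ~ M (phi (c i0)))) => [|hind]; last first.
    exists n.+1, b; split.
      move=> x; have [c hc] := hb x; by exists (fun i => phi (c i));
        split => // i; exists (c i).
    move=> c hc Mc i; apply: contrapT => Mci; apply: hind.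
    have /choice[c' hc'] : forall i, exists r, phi r = c i.
      by move=> k; have [r _ <-] := hc k; exists r.
    exists c', i; split; last by rewrite hc'.
    by under eq_bigr => k _ do rewrite hc'.
  move=> [c [i0 [Mc Mi0]]].
  case: (pp (c i0)) => [[q e]|[u [v e]]].
    by case: Mi0; rewrite e rmorphM mulrC; apply: idealM.
  (* modulo [M], [b i0 = - v * sum_(i != i0) c i * b i]                       *)
  apply: (IH (fun k => b (lift i0 k))) => x; have [c' hc'] := hb x.
  exists (fun k => c' (lift i0 k) - c' i0 * v * c (lift i0 k)).
  move: hc' Mc; rewrite !(bigD1_ord i0) //= => hc' Mc.
  have -> : \sum_(k < n) phi (c' (lift i0 k) - c' i0 * v * c (lift i0 k))
    * b (lift i0 k)
    = \sum_(k < n) phi (c' (lift i0 k)) * b (lift i0 k)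
      - phi (c' i0 * v) * \sum_(k < n) phi (c (lift i0 k)) * b (lift i0 k).
    rewrite mulr_sumr -sumrB; apply: eq_bigr => k _.
    by rewrite rmorphB !rmorphM mulrBl !mulrA.
  move: hc' Mc; set S1 := \sum_(_ < n) _; set S2 := \sum_(_ < n) _ => hc' Mc.
  have -> : x - (S1 - phi (c' i0 * v) * S2) =
     (x - (phi (c' i0) * b i0 + S1)) + phi (c' i0 * v) * (phi (c i0)
       * b i0 + S2)
     + phi (c' i0) * b i0 * (phi u * phi p).
    have -> : phi u * phi p = 1 - phi v * phi (c i0).
      by rewrite -!rmorphM -(rmorph1 phi) -e -rmorphB addrK.
    by rewrite rmorphM; ring.
  apply: idealD => //; last by apply: idealM => //; apply: idealM.
  by apply: idealD => //; apply: idealM.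
have [s hs] := finite_residue_reps idlM (finD maxM).
apply: (span_deg (size s) (fun i => s`_i)) => x; have [y ys My] := hs x.
have hi : (index y s < size s)%N by rewrite index_mem.
exists (fun i : 'I_(size s) => if i == Ordinal hi then 1 else 0).
rewrite (bigD1 (Ordinal hi)) //= eqxx big1 ?addr0 ?rmorph1 ?mul1r ?nth_index //.
by move=> i /negbTE ->; rewrite rmorph0 mul0r.
Qed.

Definition bounded_at (d : D) := exists E n : nat, forall M, maximal_ideal M ->
  M d -> (forall v, adic_valuation M v -> v d%:F <= E%:Z) /\
         exists2 s, (size s <= n)%N & residue_reps M s.

(** [D / M] has dimension at most [F] over [R / p], whose cardinality is bounded independently of
    [M] by the residue field of one fixed [M0] above [p]. *)
Lemma bounded_at_prime (p : R) : p != 0 -> bezout_prime p -> bounded_at (phi p).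
Proof.
move=> p0 pp.
case: (pselect (exists2 M,
  maximal_ideal M & M (phi p))) => [[M0 max0 M0p]|h]; last first.
  by exists 0%N, 0%N => M maxM Mp; case: h; exists M.
have above M : maximal_ideal M -> M (phi p) ->
  Defs.prime_above (range phi) (phi p) M.
  move=> maxM Mp; split; first exact: maximal_prime.
  apply/seteqP; split => x.
    move=> [Mx [r _ er]]; rewrite -er in Mx *.
    have [q ->] := bezout_prime_above pp maxM Mp Mx.
    by exists (phi q); [exists q | rewrite rmorphM].
  move=> [c [q _ <-] <-]; split; last by exists (p * q); rewrite ?rmorphM.
  by rewrite mulrC; apply: idealM => //; exact: maxM.1.
have prp : prime_element_in (range phi) (phi p).
  split; [by exists p | by rewrite phi_eq0 | |].
  - move=> [c [q _ <-] e]; apply: (ideal1 max0.1); rewrite -e mulrC.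
    by apply: idealM => //; exact: max0.1.
  - move=> _ _ [a _ <-] [b _ <-] [_ [q _ <-] e].
    have {}e : p * q = a * b by apply: phi_inj; rewrite !rmorphM.
    case: (pp a) => [[q' ->]|[u [w e']]].
      by left; exists (phi q'); [exists q' | rewrite rmorphM].
    right; exists (phi (u * b + w * q)); first by exists (u * b + w * q).
    rewrite -rmorphM; congr (phi _); rewrite -[RHS]mul1r -e'.
    have -> : (u * p + w * a) * b = u * p * b + w * (a * b) by ring.
    by rewrite -e; ring.
have [[E hE] [F hF]] := dbD prp.
have [s0 hs0] := finite_residue_reps max0.1 (finD max0).
(* [sg] lifts a class modulo [M0] to [R] whenever possible, so its values on [s0] represent all of
   [R / p]. *)
have /choice[sg hsg] : forall y : D, exists r, (exists r',
  M0 (phi r' - y)) -> M0 (phi r - y).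
  move=> y; case: (pselect (exists r', M0 (phi r' - y))) => [[r hr]|h];
    first by exists r.
  by exists 0.
have hs1 (r : R) : exists2 y, y \in s0 & exists q, r - sg y = p * q.
  have [y ys My] := hs0 (phi r); exists y => //.
  apply: (bezout_prime_above pp max0 M0p); rewrite rmorphB.
  have -> : phi r - phi (sg y) = (phi r - y) - (phi (sg y) - y) by ring.
  by apply: idealB => //; [exact: max0.1 | apply: hsg; exists r].
have s00 : (0 < size s0)%N.
  by have [y ys _] := hs1 0; case: (s0) ys.
exists `|E|%N, (size s0 ^ F)%N => M maxM Mp; have idlM := maxM.1; split.
  move=> v adv; have : v (phi p)%:F <= E.
    by apply: hE; exists M, v; split => //; exact: above.
  by move=> h; apply: le_trans h _; rewrite abszE; exact: ler_norm.
have [f hf] := exists_residue_degree pp maxM Mp.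
have fF : (f <= F)%N by apply: hF; exists M; split => //; exact: above.
have [b [hb _]] := hf.
exists [seq \sum_i phi (sg s0`_(g i)) * b i | g : {ffun 'I_f -> 'I_(size s0)}].
  by rewrite size_image card_ffun !card_ord leq_pexp2l.
move=> x; have [c [hc Mc]] := hb x.
have /choice[k hk] : forall i : 'I_f, exists k : 'I_(size s0),
  M (c i - phi (sg s0`_k)).
  move=> i; have [r _ er] := hc i; have [y ys [q eq]] := hs1 r.
  have hi : (index y s0 < size s0)%N by rewrite index_mem.
  exists (Ordinal hi); rewrite /= nth_index // -er -rmorphB eq rmorphM mulrC.
  exact: idealM.
exists (\sum_i phi (sg s0`_(k i)) * b i).
  apply/mapP; exists (finfun k); first by rewrite mem_enum.
  by apply: eq_bigr => i _; rewrite ffunE.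
have -> : x - \sum_i phi (sg s0`_(k i)) * b i =
   (x - \sum_i c i * b i) + \sum_i b i * (c i - phi (sg s0`_(k i))).
  rewrite -addrA; congr (_ + _); rewrite -!sumrN -big_split /=.
  by apply: eq_bigr => i _; ring.
by apply: idealD => //; apply: ideal_sum => // i _; apply: idealM.
Qed.

(** Induction on [mu c]: a [c] that is neither a unit nor [bezout_prime] is a product of two
    non-units of smaller size. Values add up, and a maximal ideal containing [c] contains one of the
    factors. *)
Lemma bounded_at_base (c : R) : c != 0 -> bounded_at (phi c).
Proof.
have [n] := ubnP (mu c); elim: n c => // n IH c hn c0.
case: (pselect (exists c', c * c' = 1)) => [[c' e]|nu].
  exists 0%N, 0%N => M maxM Mc; case: (ideal1 maxM.1).
  by rewrite -(rmorph1 phi) -e rmorphM mulrC; apply: idealM maxM.1 _ _ _.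
case: (pselect (bezout_prime c)) => [pc|/existsNP[x /not_orP[h1 h2]]].
  exact: bounded_at_prime.
have [g [u [v [c' [x' [eg ec ex]]]]]] := bezoutR c x.
have ng : forall b', g * b' != 1.
  move=> b'; apply/eqP => e; apply: h2; exists (b' * u), (b' * v).
  by rewrite -[RHS]e eg; ring.
have nc' : forall b', c' * b' != 1.
  move=> b'; apply/eqP => e; apply: h1; exists (b' * x').
  by rewrite ec ex -[in LHS](mulr1 g) -e; ring.
have gc0 : g * c' != 0 by rewrite -ec.
have g0 : g != 0 by apply: contraNneq gc0 => ->; rewrite mul0r.
have c'0 : c' != 0 by apply: contraNneq gc0 => ->; rewrite mulr0.
have [E1 [n1 B1]] : bounded_at (phi g).
  by apply: IH => //; apply: leq_trans (mu_lt gc0 nc') _; rewrite -ec -ltnS.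
have [E2 [n2 B2]] : bounded_at (phi c').
  apply: IH => //; apply: leq_trans (mu_lt (a := c') (b := g) _ ng) _;
    rewrite mulrC -?ec //.
exists (E1 + E2)%N, (maxn n1 n2) => M maxM Mc.
have adic_bound E k d : d != 0 -> (M d -> (forall v, adic_valuation M v ->
  v d%:F <= Posz E) /\
    exists2 s, (size s <= k)%N & residue_reps M s) ->
    forall v, adic_valuation M v -> v d%:F <= Posz E.
  move=> d0 h w adw; by case: (pselect (M d)) =>
    [/h[hv _]|/(adic_eq0 maxM adw) ->//]; exact: hv.
split.
  move=> w adw; rewrite ec rmorphM tofracM (adicM adw) ?tofrac_eq0 ?phi_eq0 //.
  rewrite PoszD; apply: lerD;
    [apply: (adic_bound E1 n1) | apply: (adic_bound E2 n2)] => //;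
    rewrite ?phi_eq0 //; [exact: B1 | exact: B2].
rewrite ec rmorphM in Mc; case: (maximal_primeP maxM Mc) => h.
  have [_ [s hs rs]] := B1 M maxM h; exists s => //;
    apply: leq_trans hs (leq_maxl _ _).
have [_ [s hs rs]] := B2 M maxM h; exists s => //;
  apply: leq_trans hs (leq_maxr _ _).
Qed.

(** Otherwise the ideal [J] lies in some maximal [M]. As [R] is infinite and [D / M] finite, [M]
    contains [phi c] for some nonzero [c]. A power of [phi c] has value at least [v d], which
    produces an element of [J] outside [M]. *)
Lemma dvd_base d : d != 0 -> exists (c : R) e, c != 0 /\ phi c = e * d.
Proof.
move=> d0.
have c0M a b : a != 0 -> b != 0 -> a * b != 0 :> R.
  by move=> a0 b0; rewrite -phi_eq0 rmorphM mulf_neq0 // phi_eq0.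
pose J : set D := [set s | exists c e, c != 0 /\ s * phi c = e * d].
case: (pselect (J 1)) => [[c [e [cn0 h]]]|J1].
  by exists c, e; split => //; rewrite -h mul1r.
have idJ : idealr_closed [in J].
  apply/ideal_closedP; split => //.
  - by exists 1, 0; rewrite !mul0r oner_neq0.
  - move=> a u v [c [e [c0 h]]] [c' [e' [c'0 h']]].
    exists (c * c'), (a * e * phi c' + e' * phi c); split; first exact: c0M.
    have -> : (a * e * phi c' + e' * phi c) * d =
      a * phi c' * (e * d) + phi c * (e' * d) by ring.
    by rewrite -h -h' rmorphM; ring.
have [M maxM JM] := exists_maximal idJ.
have [s hs] := finite_residue_reps maxM.1 (finD maxM).
have [c c0 Mc] : exists2 c, c != 0 & M (phi c).
  have /choice[k hk] : forall i : nat, exists k : 'I_(size s),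
    M (phi (enumR i) - s`_k).
    move=> i; have [y ys My] := hs (phi (enumR i)).
    have hi : (index y s < size s)%N by rewrite index_mem.
    by exists (Ordinal hi); rewrite /= nth_index.
  have [i [l [il e]]] : exists i l : 'I_(size s).+1, i != l /\ k i = k l.
    apply: contrapT => hn.
    have /leq_card : injective (fun i : 'I_(size s).+1 => k i).
      move=> i l e; apply/eqP; apply: contrapT => /negP h; apply: hn;
        by exists i, l.
    by rewrite !card_ord ltnn.
  exists (enumR i - enumR l); first by rewrite subr_eq0 (inj_eq enumR_inj).
  have -> : phi (enumR i - enumR l) =
    (phi (enumR i) - s`_(k i)) - (phi (enumR l) - s`_(k l)).
    by rewrite e rmorphB; ring.
  by apply: idealB maxM.1 _ _ _ _; apply: hk.
have [v adv] := exists_adic adD maxM.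
have pc0 : phi c != 0 by rewrite phi_eq0.
have vc := adic_gt0 maxM adv pc0 Mc; have vd := adic_ge0 maxM adv d0.
pose n := `|v d%:F|%N.
have [|t [a [Mt e]]] := @adic_le_dvd D M maxM v adv (phi c ^+ n) d (expf_neq0
  _ pc0) d0.
  rewrite tofracXn (adicX adv) ?tofrac_eq0 // /n -{1}[v d%:F]gez0_abs // -[X
    in X <= _]mul1r.
  by apply: ler_wpM2r => //; rewrite -gtz0_ge1.
case: Mt; apply: JM; exists (c ^+ n), a; split; last by rewrite rmorphXn.
by rewrite -phi_eq0 rmorphXn expf_neq0.
Qed.

Lemma bounded_at_all d : d != 0 -> bounded_at d.
Proof.
move=> d0; have [c [e [c0 h]]] := dvd_base d0.
have [E [n B]] := bounded_at_base c0; exists E, n => M maxM Md.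
have [|B1 B2] := B M maxM; first by rewrite h; apply: idealM maxM.1 _ _ _.
split=> // v adv; apply: le_trans (B1 v adv).
have e0 : e != 0 by apply: contraNneq c0 => e0; rewrite -phi_eq0 h e0 mul0r.
by rewrite h tofracM (adicM adv) ?tofrac_eq0 // lerDr (adic_ge0 maxM adv).
Qed.

End BaseRing.

Lemma int_bezout (c x : int) : exists g u v c' x' : int,
  [/\ g = u * c + v * x, c = g * c' & x = g * x'].
Proof.
have [u [v e]] := Bezoutz c x.
have /dvdzP[c' ec] := dvdz_gcdl c x; have /dvdzP[x' ex] := dvdz_gcdr c x.
by exists (gcdz c x), u, v, c', x'; split => //; rewrite mulrC.
Qed.

Lemma absz_lt_mul (a b : int) : a * b != 0 -> (forall b', b * b' != 1) ->
  (absz a < absz (a * b)%R)%N.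
Proof.
rewrite mulf_eq0 negb_or abszM => /andP[a0 b0] nb.
have b1 : `|b|%N != 1%N.
  apply: contraNneq (nb b) => e.
  by rewrite -expr2 -(real_normK (num_real b)) -abszE e expr1n.
by rewrite ltn_Pmulr ?absz_gt0 //; move: b1 b0; rewrite -absz_gt0;
  case: `|b|%N => [|[]].
Qed.

Lemma poly_bezout (F : fieldType) (c x : {poly F}) : exists g u v c' x' :
  {poly F},
  [/\ g = u * c + v * x, c = g * c' & x = g * x'].
Proof.
have [[u v] /= e] := Bezoutp c x; set g := u * c + v * x in e.
have gc : g %| c by rewrite (eqp_dvdl _ e) dvdp_gcdl.
have gx : g %| x by rewrite (eqp_dvdl _ e) dvdp_gcdr.
by exists g, u, v, (c %/ g), (x %/ g); split => //; rewrite mulrC divpK.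
Qed.

Lemma size_lt_mul (F : fieldType) (a b : {poly F}) : a * b != 0 ->
  (forall b', b * b' != 1) -> (size a < size (a * b)%R)%N.
Proof.
rewrite mulf_eq0 negb_or => /andP[a0 b0] nb.
have b1 : size b != 1%N.
  apply/eqP => /eqP/size_poly1P[c c0 e]; case/eqP: (nb c^-1%:P).
  by rewrite e -polyCM divff.
rewrite size_mul //; move: b1 b0; rewrite -size_poly_gt0.
by case: (size b) => [|[|k]] // _ _; rewrite !addnS /= ltnS leq_addr.
Qed.

Lemma ADDB_bounded (D : idomainType) : ADDB_domain D ->
  forall d : D, d != 0 -> bounded_at d.
Proof.
move=> [adD finD [D0 [[_ [phi phi_inj ->]]|[q [_ [phi phi_inj ->]]]] dbD]] d d0.
  apply: (bounded_at_all phi_inj int_bezout absz_lt_mul (enumR := Posz)) => //.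
  by move=> a b [].
apply: (bounded_at_all phi_inj (@poly_bezout _) (mu :=
  fun p : {poly 'F_q} => size p)
  _ (enumR := fun n => 'X^n)) => //; first exact: size_lt_mul.
move=> a b /(congr1 (fun p : {poly 'F_q} => size p)); rewrite !size_polyXn;
  by case.
Qed.

(** * Uniform bounds at integral places *)

Lemma modp_sum_coef (K : fieldType) (p : {poly K}) n (c : 'I_n ->
  K) (F : 'I_n -> {poly K}) :
  (\sum_i c i *: F i) %% p = \sum_i c i *: (F i %% p).
Proof.
elim/big_rec2: _ => [|i x y _ <-]; first exact: mod0p.
by rewrite modpD modpZl.
Qed.

(** The [n + 1] powers of [g] modulo [p] lie in a space of dimension at most [n]; a kernel vector of
    [A] holds the coefficients of [r]. *)
Lemma exists_relation (K : fieldType) (p g : {poly K}) n : p != 0 ->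
  (size p <= n.+1)%N ->
  exists r : {poly K}, [/\ r != 0, (size r <= n.+1)%N & p %| r \Po g].
Proof.
move=> p0 sp.
pose A : 'M[K]_(n.+1, n) := \matrix_(i < n.+1) poly_rV (g ^+ i %% p).
have /rowV0Pn[v /sub_kermxP vA v0] : kermx A != 0.
  by rewrite kermx_eq0 -row_leq_rank -ltnNge ltnS rank_leq_col.
exists (rVpoly v); split.
- by apply: contraNneq v0 => h; rewrite -[v]rVpolyK h linear0.
- exact: size_poly.
have -> : rVpoly v \Po g = \sum_(i < n.+1) v 0 i *: g ^+ i.
  rewrite /comp_poly.
  rewrite (@horner_coef_wide _ n.+1); last by rewrite size_map_polyC size_poly.
  apply: eq_bigr => i _; rewrite coef_map /= mul_polyC; congr (_ *: _).
  by rewrite coef_rVpoly_ord.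
rewrite /dvdp modp_sum_coef; apply/eqP.
have -> : \sum_(i < n.+1) v 0 i *: (g ^+ i %% p) = rVpoly (v *m A).
  rewrite mulmx_sum_row linear_sum; apply: eq_bigr => i _.
  rewrite linearZ rowK /= poly_rV_K //.
  by rewrite -ltnS; apply: leq_trans sp; rewrite ltn_modp.
by rewrite vA linear0.
Qed.

Lemma inverse_of_relation (K L : fieldType) (j : {rmorphism K ->
  L}) (r : {poly K}) (x : L) :
  r != 0 -> x != 0 -> root (map_poly j r) x ->
  exists r', x^-1 = (map_poly j r').[x].
Proof.
move=> r0 x0; elim/poly_ind: r r0 => [|r c IH]; first by rewrite eqxx.
rewrite rmorphD rmorphM /= map_polyX map_polyC => rc0.
rewrite /root hornerD hornerM hornerX hornerC /=.
have [c0|c0] := eqVneq c 0.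
  rewrite c0 rmorph0 addr0 mulf_eq0 (negbTE x0) orbF; apply: IH.
  by apply: contraNneq rc0 => ->; rewrite mul0r c0 add0r.
rewrite addr_eq0 => /eqP e; exists (- c^-1 *: r).
apply: (mulIf x0); rewrite mulVf // map_polyZ hornerZ -mulrA e rmorphN fmorphV
  mulrNN mulVf //.
by rewrite fmorph_eq0.
Qed.

(* Pigeonhole on the powers of [x] modulo the maximal ideal of [W].           *)
Lemma residue_power (L : fieldType) (W : set L) (vrW : is_valuation_ring W)
    (D : idomainType) (j : {rmorphism D ->
      L}) (n R : nat) (s : seq D) (f : {poly D}) (x : L) :
  (forall d, W (j d)) -> (size s <= R)%N ->
  (forall d, exists2 y, y \in s & vpos W (j (d - y))) ->
  f \is monic -> (size f <= n.+1)%N -> W x -> vpos W (map_poly j f).[x] ->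
  vpos W (x ^+ ((R ^ n)`!.+1) - x).
Proof.
move=> WD sR hs mf sf Wx fx.
have hk k : exists c : {ffun 'I_n -> 'I_(size s)},
    vpos W (x ^+ k - \sum_(i < n) j s`_(c i) * x ^+ i).
  pose r := Pdiv.Ring.rmodp 'X^k f; pose q := Pdiv.Ring.rdivp 'X^k f.
  have e : 'X^k = q * f + r := Pdiv.RingMonic.rdivp_eq mf 'X^k.
  have sr : (size r <= n)%N.
    by rewrite -ltnS; apply: leq_trans sf;
      rewrite Pdiv.Ring.ltn_rmodp monic_neq0.
  have /choice[c hc] : forall i : 'I_n, exists k : 'I_(size s),
    vpos W (j (r`_i - s`_k)).
    move=> i; have [y ys hy] := hs r`_i.
    have hi : (index y s < size s)%N by rewrite index_mem.
    by exists (Ordinal hi); rewrite /= nth_index.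
  exists (finfun c).
  have -> : x ^+ k - \sum_(i < n) j s`_((finfun c) i) * x ^+ i =
    (map_poly j q).[x] * (map_poly j f).[x] + \sum_(i < n) x ^+ i
      * j (r`_i - s`_(c i)).
    have -> : x ^+ k = (map_poly j q).[x]
      * (map_poly j f).[x] + (map_poly j r).[x].
      by rewrite -hornerM -hornerD -rmorphM -rmorphD -e /= map_polyXn hornerXn.
    rewrite -addrA; congr (_ + _).
    rewrite (@horner_coef_wide _ n);
      last by apply: leq_trans (size_poly _ _) sr.
    rewrite -sumrB; apply: eq_bigr => i _; rewrite ffunE coef_map rmorphB /=;
      ring.
  apply: vposD => //.
    apply: vposMl => //; rewrite horner_poly; apply: vr_sum => // i _.
    by apply: vrM => //; exact: vrX.
  by apply: vpos_sum => // i _; apply: vposMl => //; exact: vrX.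
have /choice[c hc] := hk.
have [a [b [ab e]]] : exists a b : 'I_(R ^ n).+1, (a < b)%N /\ c a = c b.
  apply: contrapT => hn.
  have /leq_card : injective (fun i : 'I_(R ^ n).+1 => c i).
    move=> a b e; apply/eqP; apply: contrapT => /negP;
      rewrite neq_ltn => /orP[h|h]; apply: hn.
      by exists a, b.
    by exists b, a.
  rewrite card_ffun !card_ord ltnNge => /negP; apply.
  by case: (n) => // k; rewrite leq_exp2r.
have : vpos W (x ^+ a * (x ^+ (b - a) - 1)).
  have -> : x ^+ a * (x ^+ (b - a) - 1) =
    (x ^+ b - \sum_(i < n) j s`_(c b i)
      * x ^+ i) - (x ^+ a - \sum_(i < n) j s`_(c a i) * x ^+ i).
    by rewrite mulrBr -exprD subnKC ?(ltnW ab) // mulr1 e; ring.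
  exact: vposB.
(* Either [x] is positive, or [x^(b - a)] is congruent to 1, where [b - a] is at most [R^n] and
   hence divides its factorial. *)
have -> : x ^+ (R ^ n)`!.+1 - x = x * (x ^+ (R ^ n)`! - 1)
  by rewrite exprS mulrBr mulr1.
case/(vposM vrW) => h.
  by rewrite mulrC; apply: vposMl => //; [apply: vrB => //;
    [exact: vrX | exact: vr1] | exact: vposX h].
apply: vposMl => //.
have l0 : (0 < b - a)%N by rewrite subn_gt0.
have lR : (b - a <= R ^ n)%N by apply: leq_trans (leq_subr _ _) _;
  rewrite -ltnS.
have /dvdnP[k ->] : (b - a %| (R ^ n)`!)%N by apply: dvdn_fact; rewrite l0.
rewrite mulnC exprM subrX1 mulrC; apply: vposMl => //.
by apply: vr_sum => // i _; apply: vrX => //; apply: vrX.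
Qed.

(** * Value group and residue field of a place centered on a maximal ideal of [D] *)

Section PlaceOverPrime.
Variables (D : idomainType) (L : fieldType) (j : {rmorphism {fraction D} ->
  L}) (W : set L).
Hypothesis adD : almost_dedekind D.
Hypothesis vrW : is_valuation_ring W.
Hypothesis WD : forall d : D, W (j d%:F).
Variable d : D.
Hypothesis d0 : d != 0.
Hypothesis jd : vpos W (j d%:F).

Definition center : set D := [set e | vpos W (j e%:F)].

Lemma center_maximal : maximal_ideal center.
Proof.
apply: (nonzero_prime_maximal adD (x := d)) => //; split.
  apply/ideal_closedP; split; rewrite /center /=.
  - by rewrite tofrac0 rmorph0; exact: vpos0.
  - by rewrite tofrac1 rmorph1 => /(_ (vle_refl vrW 1)).
  - move=> a u v hu hv; rewrite tofracD tofracM rmorphD rmorphM.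
    by apply: vposD => //; apply: vposMl.
move=> u v; rewrite !inE /center /= tofracM rmorphM => /(vposM vrW)[h|h];
  apply/orP.
  by left; rewrite inE.
by right; rewrite inE.
Qed.

Variable v : {fraction D} -> int.
Hypothesis adv : adic_valuation center v.

Lemma vr_of_localization k : localization center k -> W (j k).
Proof.
move=> [a [s [ns ->]]]; rewrite fmorph_div;
  have /contrapT hs : ~ ~ vle W (j s%:F) 1 by exact: ns.
have s0 : j s%:F != 0.
  apply/eqP => s0; apply: ns; rewrite /center /= s0; exact: vpos0.
apply/vle_div => //; apply: (vle_trans vrW hs); exact/vle1.
Qed.

Lemma adic_vr k : 0 <= v k -> W (j k).
Proof. by move=> h; apply: vr_of_localization; apply/(adic_localization adv);
  right. Qed.

Lemma adic_unit k : k != 0 -> v k = 0 -> veq W (j k) 1.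
Proof.
move=> k0 vk; split; last by apply/vle1/adic_vr; rewrite vk.
have jk0 : j k != 0 by rewrite fmorph_eq0.
apply/vle_div => //; rewrite div1r -fmorphV; apply: adic_vr.
by rewrite (adicV adv) // vk oppr0.
Qed.

Lemma adicXz x (k : int) : x != 0 -> v (x ^ k) = v x * k.
Proof.
move=> x0; case: k => k; first exact: (adicX adv).
by rewrite NegzE -exprnN (adicV adv) ?expf_neq0 // (adicX adv) // mulrN.
Qed.

Lemma uniformizer : exists2 w : L, w != 0 & forall k, k != 0 ->
  veq W (j k) (w ^ (v k)).
Proof.
have [_ _ /(_ 1)[w w0 vw]] := adv.1.
have jw0 : j w != 0 by rewrite fmorph_eq0.
exists (j w) => // k k0.
have wk0 : w ^ (v k) != 0 by rewrite expfz_neq0.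
have h : veq W (j (k / w ^ (v k))) 1.
  apply: adic_unit; first by rewrite mulf_neq0 ?invr_eq0.
  by rewrite (adicM adv) ?invr_eq0 // (adicV adv) // adicXz // vw mul1r subrr.
have := veqM vrW h (veq_refl vrW (j w ^ v k)); rewrite mul1r.
by rewrite fmorph_div fmorphXz divfK // expfz_neq0.
Qed.

(** Such a [k] lies in the localization at the center: if [v k < 0], then [k^-1 = a / s] with [a] in
    the center, so [s = a k] would be there too. With [k = a / s], take [e = a s'], where [s']
    inverts [s] modulo the center. *)
Lemma residue_field_eq k : W (j k) -> exists e : D, vpos W (j (k - e%:F)).
Proof.
move=> Wk; have maxQ := center_maximal.
have [->|k0] := eqVneq k 0.
  by exists 0; rewrite tofrac0 subrr rmorph0; exact: vpos0.
have /(adic_localization adv)[a [s [ns ek]]] : k = 0 \/ 0 <= v k.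
  right; rewrite leNgt; apply/negP => vk.
  have /(adic_localization adv)[a [s [ns e]]] : k^-1 = 0 \/ 0 <= v k^-1.
    by right; rewrite (adicV adv) // oppr_ge0 ltW.
  have s0 : s != 0 by apply: contra_notN ns => /eqP->; exact: ideal0 maxQ.1.
  have sF : s%:F != 0 :> {fraction D} by rewrite tofrac_eq0.
  have kV0 : k^-1 != 0 by rewrite invr_eq0.
  have aF : a%:F != 0 :> {fraction D} by apply: contraNneq kV0 => a0;
    rewrite e a0 mul0r.
  have Qa : center a.
    apply: contrapT => na; have sV : s%:F^-1 != 0 by rewrite invr_eq0.
    have := adicM adv aF sV; rewrite -e !(adicV adv) // !(adic_eq0 maxQ adv) //.
    by rewrite subr0 => /eqP; rewrite oppr_eq0 => /eqP vk0; rewrite vk0 in vk.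
  have : vpos W (j a%:F * j k) by rewrite mulrC; apply: vposMl.
  have -> : j a%:F * j k = j s%:F.
    by rewrite -rmorphM; congr (j _);
      rewrite -[a%:F](divfK sF) -e mulrAC mulVf // mul1r.
  exact: ns.
have [s' hs'] := maximal_unit_mod maxQ ns.
exists (a * s').
have s0 : s%:F != 0 :> {fraction D}.
  by rewrite tofrac_eq0; apply: contra_notN ns => /eqP->; exact: ideal0 maxQ.1.
have -> : k - (a * s')%:F = k * (1 - s * s')%:F.
  have ka : k * s%:F = a%:F by rewrite ek divfK.
  by rewrite tofracB tofrac1 !tofracM mulrBr mulr1 mulrA ka.
by rewrite rmorphM; apply: vposMl.
Qed.

(** Two terms of the vanishing sum [r(x)] have equal value, so some [x^l] with [0 < l <= n] has the
    value of an element of [K]. Then [l] divides the factorial of [n], and [v d] divides that of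
    [E]. *)
Lemma group_index (E n : nat) (r : {poly {fraction D}}) (x : L) : v d%:F <=
  E%:Z ->
  r != 0 -> (size r <= n.+1)%N -> x != 0 -> root (map_poly j r) x ->
  exists k : int, veq W (x ^+ (n`! * E`!)) (j d%:F ^ k).
Proof.
move=> vE r0 sr x0 rx; have [w w0 hw] := uniformizer.
have dF : d%:F != 0 :> {fraction D} by rewrite tofrac_eq0.
have [l [z [l0 ln hx]]] : exists l z, [/\ (0 < l)%N,
  (l <= n)%N & veq W (x ^+ l) (w ^ z)].
  pose t (i : 'I_n.+1) := j r`_i * x ^+ i.
  have t0 : \sum_i t i = 0.
    move/rootP: rx; rewrite (@horner_coef_wide _ n.+1) ?size_map_poly // => h.
    by rewrite -[RHS]h; apply: eq_bigr => i _; rewrite coef_map.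
  have r_neq0 i : t i != 0 -> r`_i != 0.
    by apply: contraNneq => h; rewrite /t h rmorph0 mul0r.
  have tN0 : exists i, t i != 0.
    have hi : ((size r).-1 < n.+1)%N.
      by apply: leq_trans sr; rewrite prednK // size_poly_gt0.
    exists (Ordinal hi); rewrite /t /= mulf_neq0 ?expf_neq0 // fmorph_eq0.
    by rewrite -/(lead_coef r) lead_coef_eq0.
  have wlg (i k : 'I_n.+1) : (i < k)%N -> t i != 0 -> veq W (t i) (t k) ->
    exists l z, [/\ (0 < l)%N, (l <= n)%N & veq W (x ^+ l) (w ^ z)].
    move=> ik ti h; have tk := veq_neq0 h ti.
    exists (k - i)%N, (v (r`_i / r`_k)); split.
    - by rewrite subn_gt0.
    - by apply: leq_trans (leq_subr _ _) _; rewrite -ltnS.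
    have rk := r_neq0 _ tk; have ri := r_neq0 _ ti.
    apply: (veq_trans vrW _ (hw _ _)); last by rewrite mulf_neq0 ?invr_eq0.
    have jrk : j r`_k != 0 by rewrite fmorph_eq0.
    have jri : j r`_i != 0 by rewrite fmorph_eq0.
    have := veqM vrW (veq_sym h) (veq_refl vrW ((j r`_k)^-1 * (x ^+ i)^-1)).
    rewrite /t fmorph_div.
    have -> : j r`_k * x ^+ k * ((j r`_k)^-1 * (x ^+ i)^-1) = x ^+ (k - i).
      rewrite -[in x ^+ k](subnK (ltnW ik)) exprD; field.
      by rewrite jrk expf_neq0.
    have -> // : j r`_i * x ^+ i * ((j r`_k)^-1 * (x ^+ i)^-1) =
      j r`_i / j r`_k.
    by field; rewrite jrk expf_neq0.
  have [i [k [ik ti h]]] := sum0_veq vrW t0 tN0.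
  move: ik; rewrite neq_ltn => /orP[ik|ki]; first exact: (wlg i k).
  by apply: (wlg k i) => //; [exact: veq_neq0 h ti | exact: veq_sym].
have /dvdnP[a ->] : (l %| n`!)%N by apply: dvdn_fact; rewrite l0.
have vd : 0 < v d%:F by apply: (adic_gt0 center_maximal adv).
pose e := `|v d%:F|%N.
have ee : v d%:F = e%:Z by rewrite /e gtz0_abs.
have /dvdnP[b ->] : (e %| E`!)%N.
  by apply: dvdn_fact; rewrite -ltz_nat -lez_nat -ee vd.
exists (z * a * b).
have -> : (a * l * (b * e) = l * (a * b * e))%N by ring.
rewrite exprM; apply: (veq_trans vrW (veqX vrW _ hx)).
have -> : (w ^ z) ^+ (a * b * e) = (w ^ v d%:F) ^ (z * a * b).
  rewrite exprnP !exprz_exp ee; congr (w ^ _); lia.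
apply: veqXz => //; first by rewrite expfz_neq0.
by apply: veq_sym; exact: hw.
Qed.

(** Leading terms with coefficient in the center are dropped; the first remaining leading
    coefficient is inverted modulo the center. *)
Lemma monic_residue_relation n (c : nat -> D) (x : L) : W x ->
  vpos W (\sum_(i < n) j (c i)%:F * x ^+ i) ->
  (exists2 i, (i < n)%N & ~ center (c i)) ->
  exists f : {poly D}, [/\ f \is monic, (size f <= n)%N
    & vpos W (map_poly (j \o Defs.tofrac) f).[x]].
Proof.
move=> Wx; elim: n => [|n IH]; first by move=> _ [].
rewrite big_ord_recr /= => hs [i hi hc].
case: (pselect (center (c n))) => [hn|hn].
  have [||f [mf sf fx]] := IH; last by exists f; split => //; exact: leqW.
  - rewrite -(addrK (j (c n)%:F * x ^+ n) (\sum_(_ < n) _)); apply: vposB => //.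
    by rewrite mulrC; apply: vposMl => //; exact: vrX.
  - exists i => //; move: hi; rewrite ltnS leq_eqVlt => /orP[/eqP e|//].
    by case: hc; rewrite e.
have [s hs'] := maximal_unit_mod center_maximal hn.
exists ('X^n + \poly_(i < n) (s * c i)); split.
- by rewrite monicE lead_coefDl ?lead_coefXn // size_polyXn ltnS size_poly.
- by apply: leq_trans (size_polyD _ _) _;
  rewrite size_polyXn geq_max leqnn ltnW // ltnS size_poly.
rewrite rmorphD /= map_polyXn hornerD hornerXn.
have -> : (map_poly (j \o Defs.tofrac) (\poly_(i < n) (s * c i))).[x] =
    \sum_(i < n) j (s * c i)%:F * x ^+ i.
  rewrite (@horner_coef_wide _ n);
    last by apply: leq_trans (size_poly _ _) (size_poly _ _).
  by apply: eq_bigr => k _; rewrite coef_map coef_poly ltn_ord.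
have -> : x ^+ n + \sum_(i < n) j (s * c i)%:F * x ^+ i =
   j s%:F * (\sum_(i < n) j (c i)%:F * x ^+ i + j (c n)%:F * x ^+ n) +
   x ^+ n * j (1 - c n * s)%:F.
  have -> : \sum_(i < n) j (s * c i)%:F * x ^+ i =
    j s%:F * \sum_(i < n) j (c i)%:F * x ^+ i.
    by rewrite mulr_sumr; apply: eq_bigr => k _; rewrite tofracM rmorphM mulrA.
  by rewrite tofracB tofrac1 tofracM rmorphB rmorph1 rmorphM; ring.
by apply: vposD => //; apply: vposMl => //; exact: vrX.
Qed.

(** Dividing [r] by its coefficient of smallest value and reducing the coefficients to [D] gives a
    nontrivial relation for the residue of [x], which is made monic for [residue_power]. *)
Lemma residue_bound (R n : nat) (s : seq D) (r : {poly {fraction D}}) (x : L) :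
  (size s <= R)%N -> residue_reps center s ->
  r != 0 -> (size r <= n.+1)%N -> root (map_poly j r) x -> W x ->
  vpos W (x ^+ ((R ^ n)`!.+1) - x).
Proof.
move=> sR hs r0 sr rx Wx.
have [l ln hl] := exists_min_value vrW (fun i => j r`_i) (ltn0Sn n).
have rl0 : r`_l != 0.
  have lr : lead_coef r != 0 by rewrite lead_coef_eq0.
  have /hl : ((size r).-1 < n.+1)%N by apply: leq_trans sr;
    rewrite prednK // size_poly_gt0.
  move=> /vle_eq0 h; apply: contraNneq lr => rl; rewrite -(fmorph_eq0 j).
  by apply/eqP/h; rewrite rl rmorph0.
have jrl : j r`_l != 0 by rewrite fmorph_eq0.
have /choice[c hc] : forall i : nat, exists e : D,
    (i < n.+1)%N -> vpos W (j (r`_i / r`_l - e%:F)).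
  move=> i; case: (ltnP i n.+1) => hi; last by exists 0.
  have [|e he] := @residue_field_eq (r`_i / r`_l); last by exists e.
  by rewrite fmorph_div; apply/vle_div => //; exact: hl.
have [||f [mf sf fx]] := @monic_residue_relation n.+1 c x Wx.
- have e0 : \sum_(i < n.+1) j (r`_i / r`_l) * x ^+ i = 0.
    move/rootP: rx; rewrite (@horner_coef_wide _ n.+1) ?size_map_poly // => h.
    rewrite -[RHS](mulr0 (j r`_l)^-1) -[in RHS]h mulr_sumr;
      apply: eq_bigr => i _.
    by rewrite coef_map fmorph_div mulrA [_ * j _]mulrC.
  have -> : \sum_(i < n.+1) j (c i)%:F * x ^+ i =
      - \sum_(i < n.+1) x ^+ i * j (r`_i / r`_l - (c i)%:F).
    apply/eqP; rewrite -addr_eq0 -big_split /= -[X in _ == X]e0.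
    by apply/eqP/eq_bigr => i _; rewrite rmorphB; ring.
  apply: vposN => //; apply: vpos_sum => // i _; apply: vposMl => //;
    first exact: vrX.
  exact: hc.
- exists l => // hcl; have := hc l ln; rewrite divff // rmorphB rmorph1.
  by move=> h; have := vposD vrW h hcl; rewrite subrK => /(_ (vle_refl vrW 1)).
apply: (residue_power vrW (j :=
  (j \o Defs.tofrac)%FUN) WD sR _ mf sf Wx fx) => e.
by have [y ys hy] := hs e; exists y.
Qed.

End PlaceOverPrime.

Definition integral_place (D : idomainType) (n : nat) (t : place {fraction D})
  :=
  [/\ is_valuation_ring (pl_ring t), forall d : D, pl_ring t (pl_mor t d%:F)
    & exists p : {poly D}, [/\ p \is monic, (size p <= n.+1)%N
        & pl_eval t (map_poly Defs.tofrac p) = 0]].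

Lemma pl_eval_comp (K : fieldType) (t : place K) (r g : {poly K}) :
  pl_eval t (r \Po g) = (map_poly (pl_mor t) r).[pl_eval t g].
Proof. by rewrite !pl_evalE map_comp_poly horner_comp. Qed.

Section IntegralPlaces.
Variables (D : idomainType) (n : nat).
Implicit Type t : place {fraction D}.

Lemma integral_place_relation t g : integral_place n t ->
  exists r : {poly {fraction D}}, [/\ r != 0,
    (size r <= n.+1)%N & root (map_poly (pl_mor t) r) (pl_eval t g)].
Proof.
move=> [_ _ [p [mp sp pt]]].
have mp' : map_poly Defs.tofrac p \is monic by exact: monic_map.
have [|r [r0 sr /dvdpP[q e]]] := exists_relation g (monic_neq0 mp') (n := n).
  by rewrite size_map_poly_id0 // (monicP mp) rmorph1 oner_neq0.
by exists r; split => //; rewrite /root -pl_eval_comp e rmorphM pt mulr0.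
Qed.

Lemma integral_place_field t g : integral_place n t -> pl_eval t g != 0 ->
  range (pl_eval t) (pl_eval t g)^-1.
Proof.
move=> ht g0; have [r [r0 _ rg]] := integral_place_relation g ht.
have [r' e] := inverse_of_relation r0 g0 rg.
by exists (r' \Po g) => //; rewrite pl_eval_comp.
Qed.

Hypothesis hD : ADDB_domain D.

Lemma integral_place_uniform (T : place {fraction D} ->
  Prop) (d : D) : d != 0 ->
  (forall t, T t -> integral_place n t) -> uniform_at T d%:F.
Proof.
move=> d0 hT; have [adD _ _] := hD; have [E [R B]] := ADDB_bounded hD d0.
(* These are the exponents of [group_index] and [residue_bound]; [E] and [R] serve all maximal
   ideals containing [d], so nothing depends on the place. *)
exists (n`! * E`!)%N, ((R ^ n)`!.+1); split.
- by rewrite muln_gt0 !fact_gt0.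
- by rewrite ltnS fact_gt0.
move=> t Tt hd x [g _ <-]; have ht := hT t Tt; have [vr WD _] := ht.
have [r [r0 sr rx]] := integral_place_relation g ht.
have maxQ := center_maximal adD vr WD d0 hd.
have [v adv] := exists_adic adD maxQ.
have [vE [s sR hs]] := B _ maxQ hd.
split=> [x0|Wx].
  exact: (group_index adD vr WD d0 hd adv (vE v adv) r0 sr x0 rx).
exact: (residue_bound adD vr WD d0 hd adv sR hs r0 sr rx Wx).
Qed.

Lemma prufer_integral_places (T : place {fraction D} -> Prop) :
  (forall t, T t -> integral_place n t) ->
  prufer_domain [set f%:F | f in integral_at T].
Proof.
move=> hT.
apply: (@prufer_integral_at D {fraction D} (Defs.tofrac : {rmorphism D ->
  {fraction D}})).
- by move=> x y /eqP; rewrite tofrac_eq => /eqP.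
- exact: fraction_surj.
- by move=> t /hT[].
- by move=> t /hT ht g; apply: integral_place_field.
- move=> t /hT [vr WD [p [mp _ pt]]].
  rewrite pl_evalE map_polyX hornerX.
  apply: (integral_in_vr vr (p :=
    map_poly (pl_mor t) (map_poly Defs.tofrac p))).
  + by do 2!apply: monic_map.
  + by move=> i; rewrite !coef_map; exact: WD.
  + by rewrite /root -pl_evalE pt.
- by move=> d t /hT[_ WD _]; rewrite pl_evalC; exact: WD.
- by move=> d d0; apply: integral_place_uniform.
Qed.

End IntegralPlaces.

(** * The two rings of integer-valued polynomials *)

Lemma adic_valuation_ring (D : idomainType) (M : set D) v : maximal_ideal M ->
  adic_valuation M v -> is_valuation_ring (localization M).
Proof.
move=> maxM adv; have loc x : localization M x <-> x = 0 \/ 0 <= v x.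
  exact: adic_localization.
have vN x : v (- x) = v x.
  have [->|x0] := eqVneq x 0; first by rewrite oppr0.
  have N10 : -1 != 0 :> {fraction D} by rewrite oppr_eq0 oner_neq0.
  have : v (-1) + v (-1) = 0
    by rewrite -(adicM adv) // mulrNN mulr1 (adic1 adv).
  move/eqP; rewrite -mulr2n mulrn_eq0 /= => /eqP e.
  by rewrite -mulN1r (adicM adv) // e add0r.
split.
- by apply/loc; right; rewrite (adic1 adv).
- move=> x y hx hy.
  have [x0|x0] := eqVneq x 0.
    by rewrite x0 sub0r; apply/loc; case/loc: hy => [->|]; [left;
      rewrite oppr0 | right; rewrite vN].
  have [y0|y0] := eqVneq y 0; first by rewrite y0 subr0.
  have [e|e] := eqVneq (x - y) 0; apply/loc; first by left.
  right; have [[_ h _] _] := adv; have yN : - y != 0 by rewrite oppr_eq0.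
  apply: le_trans (h _ _ x0 yN e); rewrite vN le_min.
  case/loc: hx => [/eqP|->]; first by rewrite (negbTE x0).
  by case/loc: hy => [/eqP|->//]; rewrite (negbTE y0).
- move=> x y hx hy.
  have [x0|x0] := eqVneq x 0; first by rewrite x0 mul0r; apply/loc; left.
  have [y0|y0] := eqVneq y 0; first by rewrite y0 mulr0; apply/loc; left.
  apply/loc; right; rewrite (adicM adv) //; apply: addr_ge0.
    by case/loc: hx => [/eqP|//]; rewrite (negbTE x0).
  by case/loc: hy => [/eqP|//]; rewrite (negbTE y0).
- move=> x; have [x0|x0] := eqVneq x 0; first by left; apply/loc; left.
  case: (lerP 0 (v x)) => h; first by left; apply/loc; right.
  by right; apply/loc; right; rewrite (adicV adv) // oppr_ge0 ltW.
Qed.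

(** The denominators of [k] form an ideal [J]. It lies in no maximal [M], because the valuation ring
    [localization M] contains [k] and thus supplies a denominator outside [M]. *)
Lemma almost_dedekind_integrally_closed (D : idomainType) (L : fieldType)
    (j : {rmorphism {fraction D} -> L}) k : almost_dedekind D ->
  integralOver (j \o Defs.tofrac) (j k) -> exists d : D, k = d%:F.
Proof.
move=> adD [p mp pk].
pose J : set D := [set s | exists a : D, s%:F * k = a%:F].
case: (pselect (J 1)) => [[a e]|J1].
  by exists a; rewrite -e tofrac1 mul1r.
have idJ : idealr_closed [in J].
  apply/ideal_closedP; split => //; first by exists 0; rewrite tofrac0 mul0r.
  move=> a u v [b hb] [c hc]; exists (a * b + c).
  by rewrite !tofracD !tofracM mulrDl -mulrA hb hc.
have [M maxM JM] := exists_maximal idJ.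
have [v adv] := exists_adic adD maxM.
have [|||a [s [Ms e]]] := integral_in_vr (adic_valuation_ring maxM adv)
    (p := map_poly Defs.tofrac p) (x := k).
- exact: monic_map.
- move=> i; rewrite coef_map; exists p`_i, 1; split; first exact: ideal1 maxM.1.
  by rewrite tofrac1 divr1.
- by move: pk; rewrite map_poly_comp fmorph_root.
case: (Ms); apply: JM; exists a; rewrite e mulrC divfK //.
by rewrite tofrac_eq0; apply: contra_notN Ms => /eqP ->; exact: ideal0 maxM.1.
Qed.

(** Euclidean descent on the size of [r]. With [I] the polynomials vanishing at an element, this
    gives its minimal polynomial, both in a field and in a noncommutative algebra. *)
Lemma ideal_generator (K : fieldType) (I : {poly K} -> Prop) (r : {poly K}) :
  (forall f g, I f -> I g -> I (f - g)) -> (forall f g, I g -> I (f * g)) ->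
  I r -> r != 0 ->
  exists mu, [/\ I mu, mu \is monic, (size mu <= size r)%N & forall q,
    I q -> mu %| q].
Proof.
move=> IB IM; have [k] := ubnP (size r); elim: k r => // k IH r hk Ir r0.
case: (pselect (forall q, I q ->
  r %| q)) => [h|/existsNP[q /not_implyP[Iq /negP nrq]]].
  have l0 : (lead_coef r)^-1 != 0 by rewrite invr_eq0 lead_coef_eq0.
  exists ((lead_coef r)^-1 *: r); split.
  - by rewrite -mul_polyC; apply: IM.
  - by rewrite monicE lead_coefZ mulVf // lead_coef_eq0.
  - by rewrite size_scale.
  - by move=> q /h; rewrite dvdpZl.
have sq : (size (q %% r)%R < size r)%N by rewrite ltn_modp.
have [|||mu [Imu mmu smu hmu]] := IH (q %% r).
- exact: leq_trans sq _.
- have -> : q %% r = q - q %/ r * r by rewrite {2}(divp_eq q r) addrC addKr.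
  by apply: IB => //; apply: IM.
- exact: nrq.
by exists mu; split => //; apply: leq_trans smu (ltnW sq).
Qed.

Lemma coef_prod_XsubC_vr (L : fieldType) (W : set L) (s : seq L) :
  is_valuation_ring W -> (forall z, z \in s -> W z) ->
  forall i, W (\prod_(z <- s) ('X - z%:P))`_i.
Proof.
move=> vrW; elim: s => [|z s IH] hs i.
  by rewrite big_nil coef1; case: (i == 0)%N; [exact: vr1 | exact: vr0].
rewrite big_cons mulrBl coefB coefXM coefCM; apply: vrB => //.
  by case: (i == 0)%N; [exact: vr0 | apply: IH => y ys; apply: hs;
    rewrite inE ys orbT].
apply: vrM => //; first by apply: hs; rewrite inE eqxx.
by apply: IH => y ys; apply: hs; rewrite inE ys orbT.
Qed.

Section Lambda.
Variables (D : idomainType) (Kbar : closedFieldType).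
Variable j : {rmorphism {fraction D} -> Kbar}.
Hypothesis adD : almost_dedekind D.

(** The roots of the minimal polynomial [mu] of [z] are roots of [q], hence integral. So the
    coefficients of [mu] are integral elements of [K], that is, elements of [D]. *)
Lemma Lambda_of_integral n (z : Kbar) (r : {poly {fraction D}}) :
  r != 0 -> (size r <= n.+1)%N -> root (map_poly j r) z ->
  integralOver (j \o Defs.tofrac) z -> Lambda j n z.
Proof.
move=> r0 sr rz [q mq qz].
have [||mu [Imu mmu smu hmu]] :=
  @ideal_generator _ (fun f => root (map_poly j f) z) r _ _ rz r0.
- by move=> f g /rootP hf /rootP hg; apply/rootP;
  rewrite rmorphB hornerD hornerN hf hg subr0.
- by move=> f g /rootP hg; apply/rootP; rewrite rmorphM hornerM hg mulr0.
have mu_q : mu %| map_poly Defs.tofrac q by apply: hmu; rewrite -map_poly_comp.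
have coefD i : exists d : D, mu`_i = d%:F.
  apply: (almost_dedekind_integrally_closed (j := j)) => //;
    apply/integralP => W vrW WD.
  have [s es] := closed_field_poly_normal (map_poly j mu).
  have ms : map_poly j mu \is monic by exact: monic_map.
  rewrite (monicP ms) scale1r in es.
  have -> : j mu`_i = (map_poly j mu)`_i by rewrite coef_map.
  rewrite es; apply: coef_prod_XsubC_vr => // y ys.
  apply: (integral_in_vr vrW (p := map_poly (j \o Defs.tofrac) q)).
  - exact: monic_map.
  - by move=> k; rewrite coef_map; exact: WD.
  - have /dvdpP[h e] := mu_q.
    rewrite map_poly_comp e rmorphM /= rootM es; apply/orP; right.
    by rewrite root_prod_XsubC.
have /choice[c hc] := coefD.
pose P := \poly_(i < size mu) c i.
have eP : map_poly Defs.tofrac P = mu.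
  apply/polyP => i; rewrite coef_map coef_poly; case: ltnP => h /=;
    first by rewrite hc.
  by rewrite tofrac0 nth_default.
have inj_tofrac : injective (Defs.tofrac : D -> {fraction D}).
  by move=> x y /eqP; rewrite tofrac_eq => /eqP.
have mP : P \is monic.
  by rewrite monicE -tofrac_eq tofrac1 -(lead_coef_map_inj inj_tofrac)
    ?tofrac0 // eP -monicE.
have sP : size P = size mu by rewrite -eP size_map_inj_poly // tofrac0.
have P0 := monic_neq0 mP.
(* [Lambda] requires degree exactly [n]; the power of ['X] makes up the difference. *)
exists ('X^(n.+1 - size P) * P); split.
- by rewrite monicMl ?monicXn.
- rewrite size_monicM ?monicXn // size_polyXn addSn /= subnK // sP.
  exact: leq_trans smu sr.
- by rewrite !rmorphM /= rootM eP Imu orbT.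
Qed.

Definition Lambda_place n (t : place {fraction D}) :=
  exists x W, [/\ t = Place j x W, Lambda j n x, is_valuation_ring W
                & forall d : D, W (j d%:F)].

Lemma Lambda_place_integral n t : Lambda_place n t -> integral_place n t.
Proof.
move=> [x [W [-> [p [mp sp px]] vrW WD]]]; split => //.
by exists p; split; [| rewrite sp | exact/rootP].
Qed.

Lemma Int_LambdaE n : Int_Lambda j n = integral_at (Lambda_place n).
Proof.
apply/seteqP; split => f hf.
  move=> t [x [W [-> /hf [p [mp sp px]] vrW WD]]].
  apply: (integral_in_vr vrW _ _ px); first by do 2!apply: monic_map.
  by move=> i; rewrite !coef_map; exact: WD.
move=> x Lx.
(* The trivial valuation ring turns [x] into a place, from which the degree bound for [f(x)] is
   obtained. *)
have [W0 vr0 WD0] : exists2 W : set Kbar, is_valuation_ring W & forall d : D,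
  W (j d%:F).
  by exists setT => //; split => //; left.
pose t0 := Place j x W0.
have ht0 : integral_place n t0 by apply: Lambda_place_integral; exists x, W0.
have [r [r0 sr rx]] := integral_place_relation f ht0.
apply: (Lambda_of_integral r0 sr rx); apply/integralP => W vrW WD.
by apply: (hf (Place j x W)); exists x, W.
Qed.

End Lambda.

Lemma horner_alg_comp (R : comNzRingType) (B : algType R) (b : B) (q f : {poly
  R}) :
  horner_alg b (q \Po f) = horner_alg (horner_alg b f) q.
Proof.
elim/poly_ind: q => [|q c IH]; first by rewrite comp_poly0 !rmorph0.
by rewrite comp_poly_MXaddC !rmorphD !rmorphM /= IH !horner_algC horner_algX.
Qed.

(* Cayley-Hamilton for left multiplication by [a] on the generators of [A].   *)
Lemma finite_algebra_integral (D : idomainType) (A : algType D) n (g : 'I_n ->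
  A) :
  (forall a, exists c : 'I_n -> D, a = \sum_i c i *: g i) ->
  forall a : A, exists p : {poly D},
    [/\ p \is monic, size p = n.+1 & horner_alg a p = 0].
Proof.
case: n g => [|n] g hg a.
  by have [c] := hg 1; rewrite big_ord0 => /eqP; rewrite oner_eq0.
have /choice[c hc] : forall i, exists c : 'I_n.+1 ->
  D, a * g i = \sum_k c k *: g k.
  by move=> i; exact: hg.
pose M : 'M[D]_n.+1 := \matrix_(i, k) c i k.
pose comb (u : 'rV[D]_n.+1) := \sum_i u 0 i *: g i.
have combM u : comb (u *m M) = a * comb u.
  rewrite /comb mulr_sumr.
  under eq_bigr => k _ do rewrite mxE scaler_suml.
  rewrite exchange_big; apply: eq_bigr => i _ /=.
  rewrite -scalerAr hc scaler_sumr; apply: eq_bigr => k _.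
  by rewrite mxE scalerA.
have combP q : forall u, comb (u *m horner_mx M q) = horner_alg a q * comb u.
  elim/poly_ind: q => [|q e IH] u.
    rewrite !rmorph0 mulmx0 mul0r /comb big1 // => i _; by rewrite mxE scale0r.
  rewrite [q * 'X]mulrC !rmorphD !rmorphM /= horner_mx_X horner_mx_C
    horner_algX horner_algC.
  have -> : u *m (M * horner_mx M q + e%:M) = u *m M *m horner_mx M q + e *: u.
    by rewrite mulmxDr mulmxA mul_mx_scalar.
  have combD x y : comb (x + e *: y) = comb x + e *: comb y.
    rewrite /comb scaler_sumr -big_split; apply: eq_bigr => i _ /=.
    by rewrite !mxE scalerDl scalerA.
  rewrite combD IH combM mulrDl -scalerAl mul1r mulrA; congr (_ * _ + _).
  (* [A] need not be commutative, but polynomials in [a] commute with [a]. *)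
  have : horner_alg a (q * 'X) = horner_alg a ('X * q) by rewrite mulrC.
  by rewrite !rmorphM /= horner_algX.
exists (char_poly M); split;
  [exact: char_poly_monic | by rewrite size_char_poly |].
have [u hu] := hg 1.
have e1 : comb (\row_i u i) = 1.
  by rewrite [RHS]hu; apply: eq_bigr => i _; rewrite mxE.
rewrite -[LHS]mulr1 -e1 -combP Cayley_Hamilton mulmx0 /comb big1 // => i _.
by rewrite mxE scale0r.
Qed.

Section Algebra.
Variables (D : idomainType) (A : algType D) (B : algType {fraction D}).
Variable iota : {rmorphism A -> B}.
Hypothesis iotaZ : forall (d : D) (a : A), iota (d *: a) = d%:F *: iota a.
Variable n : nat.
Hypothesis genA : forall a : A, exists p : {poly D},
    [/\ p \is monic, size p = n.+1 & horner_alg a p = 0].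

Lemma horner_alg_iota a (p : {poly D}) :
  horner_alg (iota a) (map_poly Defs.tofrac p) = iota (horner_alg a p).
Proof.
elim/poly_ind: p => [|p c IH]; first by rewrite !rmorph0.
rewrite rmorphD rmorphM /= map_polyX map_polyC !rmorphD !rmorphM /= IH.
by rewrite !horner_algX !horner_algC iotaZ rmorph1.
Qed.

(** The second condition makes the point a root of the minimal polynomial of [iota a]. *)
Definition algebra_place (t : place {fraction D}) :=
  integral_place n t /\ exists a, forall r, horner_alg (iota a) r = 0 ->
    pl_eval t r = 0.

(* Every irreducible factor of the minimal polynomial of [a] gives a field in *)
(* which valuation rings detect the integrality of [f a].                     *)
Lemma Int_algE : Int_alg iota = integral_at algebra_place.
Proof.
apply/seteqP; split => f hf.
  move=> t [[vr WD _] [a ha]].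
  have [q mq] := hf a; rewrite -horner_alg_comp => /ha;
    rewrite pl_eval_comp => /rootP h.
  apply: (integral_in_vr vr _ _ h); first by do 2!apply: monic_map.
  by move=> i; rewrite !coef_map; exact: WD.
move=> a; have [p [mp sp pa]] := genA a.
pose I r := horner_alg (iota a) r = 0.
have mp' : map_poly Defs.tofrac p \is monic by exact: monic_map.
have Ip : I (map_poly Defs.tofrac p) by rewrite /I horner_alg_iota pa rmorph0.
have [||mu [Imu mmu _ hmu]] := @ideal_generator _ I _ _ _ Ip (monic_neq0 mp').
- by move=> x y hx hy; rewrite /I rmorphB /= hx hy subr0.
- by move=> x y hy; rewrite /I rmorphM /= hy mulr0.
(* Induction on the size of a divisor [nu] of [mu]. For reducible [nu], the monic polynomials
   obtained for two factors are multiplied, so repeated factors of [mu] cause no trouble. *)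
suff H (nu : {poly {fraction D}}) : nu != 0 -> nu %| mu ->
    exists2 q : {poly D}, q \is monic & nu %| map_poly Defs.tofrac q \Po f.
  have [q mq /dvdpP[h e]] := H mu (monic_neq0 mmu) (dvdpp mu).
  by exists q => //; rewrite -horner_alg_comp e rmorphM /= Imu mulr0.
have [k] := ubnP (size nu).
elim: k nu => // k IH nu hk nu0 nu_mu.
case: (pselect (irreducible_poly nu)) => [irr|red].
  have [L _ [z rz _]] := irredp_FAdjoin irr.
  pose j : {rmorphism {fraction D} -> L} := GRing.in_alg L.
  have zI r : I r -> (map_poly j r).[z] = 0.
    move=> /hmu h; have /dvdpP[h' ->] := dvdp_trans nu_mu h.
    by rewrite rmorphM hornerM (rootP rz) mulr0.
  have : integralOver (j \o Defs.tofrac) (map_poly j f).[z].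
    apply/integralP => W vrW WD; apply: (hf (Place j z W)); split;
      last by exists a => r /zI.
    by split => //; exists p; split; [| rewrite sp | exact: zI].
  (* The irreducible [nu] shares the root [z] with [q(f)], hence divides it. *)
  move=> [q mq /rootP qz]; exists q => //.
  set r := map_poly _ q \Po f.
  have rz' : root (map_poly j r) z.
    by apply/rootP; rewrite map_comp_poly horner_comp -map_poly_comp.
  have [/eqP cop|ncop] := boolP (size (gcdp nu r) == 1)%N.
    have : coprimep (map_poly j nu) (map_poly j r)
      by rewrite coprimep_map /coprimep cop.
    by move=> /coprimep_root /(_ rz); rewrite (rootP rz') eqxx.
  have := irr.2 _ ncop (dvdp_gcdl _ _); move=> h.
  by rewrite -(eqp_dvdl _ h) dvdp_gcdr.
have [s1|s1] := leqP (size nu) 1.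
  exists 1; first exact: monic1.
  have /size_poly1P[c c0 ->] : size nu == 1%N
    by rewrite eqn_leq s1 size_poly_gt0.
  by rewrite -[X in X %| _]mulr1 mul_polyC dvdpZl // dvd1p.
have [q [q1 qnu nq]] : exists q : {poly {fraction D}}, [/\ size q != 1%N,
  q %| nu & ~~ (q %= nu)].
  apply: contrapT => h; apply: red; split => // q q1 qnu.
  by apply: contrapT => /negP h'; apply: h; exists q.
have /dvdpP[h e] := qnu.
have h0 : h != 0 by apply: contraNneq nu0 => h0; rewrite e h0 mul0r.
have q0 : q != 0 by apply: contraNneq nu0 => q0; rewrite e q0 mulr0.
have sq : (1 < size q)%N by rewrite ltn_neqAle eq_sym q1 size_poly_gt0.
have sh : (1 < size h)%N.
  rewrite ltn_neqAle size_poly_gt0 h0 andbT eq_sym;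
    apply: contraNN nq => /size_poly1P[c c0 eh].
  by rewrite e eh mul_polyC eqp_sym eqp_scale.
have sE : size nu = (size h + size q).-1 by rewrite e size_mul.
have hnu : h %| nu by rewrite e dvdp_mulr.
have [|q1' mq1 d1] := IH h _ h0 (dvdp_trans hnu nu_mu).
  rewrite -ltnS; apply: leq_trans hk; rewrite ltnS sE.
  by case: (size q) sq => [|[|x]] // _; rewrite !addnS /= ltnS leq_addr.
have [|q2' mq2 d2] := IH q _ q0 (dvdp_trans qnu nu_mu).
  rewrite -ltnS; apply: leq_trans hk; rewrite ltnS sE.
  by case: (size h) sh => [|[|x]] // _; rewrite !addSn /= ltnS leq_addl.
exists (q1' * q2'); first by rewrite monicMl.
by rewrite rmorphM /= comp_polyM e dvdp_mul.
Qed.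

End Algebra.

Theorem corollary4p12 (D : idomainType) (hD : ADDB_domain D) :
  (forall (Kbar : closedFieldType) (j : {rmorphism {fraction D} -> Kbar}),
     algebraic_closure j ->
     forall n : nat, (1 <= n)%N ->
       prufer_domain [set f%:F | f in Int_Lambda j n]) /\
  (forall (A : algType D) (B : algType {fraction D})
          (iota : {rmorphism A -> B}),
     scalar_extension iota ->
     torsion_free A -> finitely_generated A ->
     image_A iota `&` image_K B = image_D B ->
     prufer_domain [set f%:F | f in Int_alg iota]).
Proof.
have [adD _ _] := hD; split.
  move=> Kbar j _ n _; rewrite (Int_LambdaE j adD).
  apply: (@prufer_integral_places D n hD) => t; exact: Lambda_place_integral.
move=> A B iota [iotaZ _ _] _ [n [g hg]] _.
rewrite (Int_algE iotaZ (finite_algebra_integral hg)).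
by apply: (@prufer_integral_places D n hD) => t [].
Qed.
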